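(* For each $n \ge 1$ let $M_n$ be an $n\times n$ random matrix whose entries are independent random variables, each taking the values $+1$ and $-1$ with probability $1/2$ each. Then asymptotically almost surely $$|\mathrm{Per}(M_n)| = n^{(\frac{1}{2}+o(1))n},$$ i.e. for every $\varepsilon>0$, $$\mathbb{P}\left( n^{(\frac12-\varepsilon)n} \le |\mathrm{Per}(M_n)| \le n^{(\frac12+\varepsilon)n}\right) \to 1 \quad \text{as } n\to\infty.$$
   Context: For an $n\times n$ matrix $M=(a_{ij})$, the permanent is $\mathrm{Per}(M) := \sum_{\sigma\in S_n}\prod_{i=1}^n a_{i\sigma(i)}$. *)

(* Defs.v *)
From HB Require Import structures.
From mathcomp Require Import all_boot all_order all_algebra all_fingroup.
From mathcomp Require Import all_classical all_reals all_analysis.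

Set Implicit Arguments.
Unset Strict Implicit.
Unset Printing Implicit Defensive.

Import Order.TTheory GRing.Theory Num.Theory.
Import numFieldNormedType.Exports.

Local Open Scope classical_set_scope.
Local Open Scope ring_scope.

Definition permanent (R : comNzRingType) (n : nat) (A : 'M[R]_n) : R :=
  \sum_(s : 'S_n) \prod_(i < n) A i (s i).

(* Mutual (not merely pairwise) independence: the product rule is required for
   every subfamily J of the finite index type I. *)
Definition mutually_independent (d : measure_display) (T : measurableType d)
    (R : realType) (P : probability T R) (I : finType)
    (X : I -> {RV P >-> R}) : Prop :=
  forall (J : {set I}) (B : I -> set R),
    (forall i, i \in J -> measurable (B i)) ->
    P (\bigcap_(i in [set` J]) (X i @^-1` B i)) =
    (\prod_(i in J) P (X i @^-1` B i))%E.

Definition rademacher (d : measure_display) (T : measurableType d)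
    (R : realType) (P : probability T R) (X : {RV P >-> R}) : Prop :=
  P (X @^-1` [set 1]) = (2^-1)%:E /\ P (X @^-1` [set -1]) = (2^-1)%:E.

Definition random_matrix (d : measure_display) (T : measurableType d)
    (R : realType) (P : probability T R) (n : nat)
    (X : 'I_n * 'I_n -> {RV P >-> R}) (w : T) : 'M[R]_n :=
  \matrix_(i < n, j < n) X (i, j) w.

(* Main.v *)
(** Upper bound: the second moment of the permanent is n!, so Markov applies.

    Lower bound: expose the rows one at a time. When s rows remain, call a set B of
    s columns heavy if the permanent of the exposed rows on the other columns is at
    least L in absolute value; let N be the number of heavy sets. A flag is a heavy
    B with one of its elements j, and the degree of the shadow B \ j is the number
    of heavy sets above it. By Littlewood-Offord a shadow of degree D is heavy at
    level L sqrt(D) up to a small loss, with high probability, while a shadow of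
    degree at least 1 stays heavy at level L with probability 1/2, independently
    for the shadows of one B. An entropy inequality bounds the average of ln D over
    the flags by ln(s! N) / s, so the number of shadows is at least (s! N)^(1 - 1/s)
    / (s - 1)!, that is, the density y = ln(s! N) / (s ln n) does not decrease when
    passing to the shadow. If a positive share of the flags has degree n^(1-c) or
    less, then y increases by a multiple of 1/s; as y <= 1 and y = 1 - O(1/ln n) at
    the start, this happens o(n) times as long as s >= eps n, and L gains a factor
    n^(1/2-c) at all other steps. During the last eps n rows L is kept fixed and
    1 - y is almost a supermartingale starting at O(1/ln n), so that at the last
    row at least n^(9/10) singletons are heavy, and Littlewood-Offord finishes. *)

Require Import Defs.
From HB Require Import structures.
From mathcomp Require Import all_boot all_order all_algebra all_fingroup.
From mathcomp Require Import all_classical all_reals all_analysis.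
From mathcomp Require Import ring lra zify.
From mathcomp Require Import fintype finset.

Set Implicit Arguments.
Unset Strict Implicit.
Unset Printing Implicit Defensive.

Import Order.TTheory GRing.Theory Num.Theory.

Local Open Scope ring_scope.

(** * Central binomial coefficients *)

Lemma leq_binS (n m : nat) : (m.+1 <= n - m)%N -> ('C(n, m) <= 'C(n, m.+1))%N.
Proof.
move=> h; rewrite -(leq_pmul2l (ltn0Sn m)) mul_bin_left.
by rewrite leq_mul2r h orbT.
Qed.

Lemma leq_bin_half (n m : nat) : ('C(n, m) <= 'C(n, n./2))%N.
Proof.
have H k : (k <= n./2)%N -> ('C(n, n./2 - k) <= 'C(n, n./2))%N.
  elim: k => [|k IH] hk; first by rewrite subn0.
  apply: leq_trans (IH (ltnW hk)).
  by rewrite -(subnSK hk); apply: leq_binS; lia.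
have [hm|hm] := leqP m n./2; first by rewrite -(subKn hm); apply: H; lia.
have [hn|hn] := ltnP n m; first by rewrite bin_small.
rewrite -bin_sub // (_ : n - m = n./2 - (n./2 - (n - m)))%N; last by lia.
by apply: H; lia.
Qed.

(** Induction on [m]: consecutive central coefficients have ratio 2(2m+1)/(m+1), and (2m+1)(2m+3) <=
    4(m+1)^2. *)
Lemma central_bin_bound (m : nat) : ('C(m.*2, m) ^ 2 * m.*2.+1 <= 16 ^ m)%N.
Proof.
elim: m => [|m IH]; first by [].
have h1 : ('C(m.+1.*2, m.+1) = 2 * 'C(m.*2.+1, m))%N.
  have := mul_bin_diag m.+1.*2 m; rewrite doubleS /=.
  rewrite -[X in (X * _)%N = _]/(m.+1.*2) -[m.+1.*2]mul2n mulnC mulnA [(_ * 2)%N]mulnC.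
  by nia.
have h2 := mul_bin_down m.*2.+1 m; rewrite /= in h2.
have h3 : (m.*2.+1 - m = m.+1)%N by lia.
rewrite h3 in h2.
have h4 : (m.+1 * 'C(m.+1.*2, m.+1) = 2 * m.*2.+1 * 'C(m.*2, m))%N by rewrite h1; lia.
rewrite -(leq_pmul2l (_ : 0 < m.+1 ^ 2)%N) //.
rewrite mulnA -expnMn h4 expnMn.
have -> : ((2 * m.*2.+1) ^ 2 * 'C(m.*2, m) ^ 2 * m.+1.*2.+1
          = 4 * m.*2.+1 * m.+1.*2.+1 * ('C(m.*2, m) ^ 2 * m.*2.+1))%N by ring.
apply: (@leq_trans (4 * m.*2.+1 * m.+1.*2.+1 * 16 ^ m)%N); first by rewrite leq_mul2l IH orbT.
rewrite (expnS 16); apply: (@leq_trans (m.+1 ^ 2 * 16 * 16 ^ m)%N); last by rewrite !mulnA.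
by rewrite leq_mul2r; apply/orP; right; rewrite -!mul2n; nia.
Qed.

(** In the form C(n, m) <= 2^n / sqrt n this feeds the Littlewood-Offord bound. Odd n reduces to n +
    1, whose central coefficient is twice that of n. *)
Lemma bin_sqr_bound (n m : nat) : ('C(n, m) ^ 2 * n <= 4 ^ n)%N.
Proof.
apply: (@leq_trans ('C(n, n./2) ^ 2 * n)%N).
  by rewrite leq_mul2r leq_exp2r // leq_bin_half orbT.
have e16 j : (16 ^ j = 4 ^ j.*2)%N by rewrite -mul2n expnM.
move: n./2 (odd_double_half n) => k; case: (odd n) => /= <-; rewrite ?add0n ?add1n; last first.
  apply: (@leq_trans ('C(k.*2, k) ^ 2 * k.*2.+1)%N); first by rewrite leq_mul2l leqnSn orbT.
  by rewrite -e16 central_bin_bound.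
have h1 : ('C(k.+1.*2, k.+1) = 2 * 'C(k.*2.+1, k))%N.
  rewrite doubleS binS; have := @bin_sub k.*2.+1 k; rewrite (_ : k.*2.+1 - k = k.+1)%N; last by lia.
  by move=> ->; lia.
have := central_bin_bound k.+1; rewrite h1 expnMn e16 doubleS !expnS; nia.
Qed.

(** * Littlewood-Offord bounds *)

Section LYM.
Variables (R : realType) (T : finType) (w : T -> R).

(* Removing one point of Y averages the weights 1/C(#|Y|, #|A|); if Y itself lies
   in the window, all other sums lie in a window shorter by 1. *)
Lemma lym_window (Y : {set T}) (g z : R) :
  (forall i, i \in Y -> 1 <= w i) -> -1 <= g ->
  \sum_(A : {set T} | (A \subset Y) && (z < \sum_(i in A) w i < z + g))
     ('C(#|Y|, #|A|)%:R)^-1 <= g + 1 :> R.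
Proof.
have [D eD] : exists D, #|Y| == D by exists #|Y|.
elim: D Y g eD => [|D IH] Y g eD hw hg.
  have Y0 : Y = set0 by apply/eqP; rewrite -cards_eq0 (eqP eD).
  rewrite big_mkcond (bigD1 set0) //= [X in _ + X]big1 => [|A]; last first.
    by rewrite Y0 subset0 => /negbTE ->.
  rewrite Y0 cards0 bin0 invr1 addr0 sub0set big_set0 /=.
  by case: ifP => [/andP[]|_]; lra.
(* The recursion shortens the window by 1, so lengths down to -1 occur; a window of negative length
   is empty. *)
have [g0|g0] := ltP g 0.
  by rewrite big1 => [|A /andP[_ /andP[]]]; lra.
have cY : (0 : R) < D.+1%:R by rewrite ltr0n.
pose win (A : {set T}) := z < \sum_(i in A) w i < z + g.
(* Double counting of the pairs (A, i) with i in Y outside A; the weights match because (D+1) C(D,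
   #|A|) = (D+1-#|A|) C(D+1, #|A|). *)
have E : \sum_(A : {set T} | (A \subset Y) && win A) ('C(#|Y|, #|A|)%:R)^-1 =
   (win Y)%:R + D.+1%:R^-1 * \sum_(i in Y) \sum_(A : {set T} | (A \subset Y :\ i) && win A)
     ('C(#|Y :\ i|, #|A|)%:R)^-1 :> R.
  rewrite big_mkcond (bigD1 Y) //= subxx /= (eqP eD) binn invr1; congr (_ + _).
    by case: (win Y).
  rewrite (exchange_big_dep (fun A : {set T} => (A \proper Y) && win A)) /=; last first.
    move=> i A iY /andP[sA ->]; rewrite andbT; apply: (sub_proper_trans sA).
    exact: properD1.
  rewrite mulr_sumr -big_mkcondr /=.
  apply: eq_big => [A|A].
    by rewrite properEneq andbA.
  move=> /andP[AY /andP[sA wA]].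
  rewrite (eq_bigr (fun=> ('C(D, #|A|)%:R)^-1)); last first.
    move=> i /andP[iY _]; congr (_%:R^-1); congr ('C(_, _)).
    by have := cardsD1 i Y; rewrite iY (eqP eD) => -[].
  rewrite sumr_const.
  have -> : #|[pred i in Y | (A \subset Y :\ i) && win A]| = #|Y :\: A|.
    apply: eq_card => i; rewrite !inE subsetD1 sA wA andbT.
    by rewrite andbC.
  have hA : (#|A| <= D)%N.
    by rewrite -ltnS -(eqP eD); apply: proper_card; rewrite properEneq AY.
  rewrite cardsD (setIidPr sA) (eqP eD) -[X in _ * X]mulr_natl.
  have h : (D.+1 * 'C(D, #|A|) = (D.+1 - #|A|) * 'C(D.+1, #|A|))%N by exact: (mul_bin_down D.+1).
  have h' : D.+1%:R * 'C(D, #|A|)%:R = (D.+1 - #|A|)%:R * 'C(D.+1, #|A|)%:R :> R.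
    by rewrite -!natrM h.
  have c1 : 'C(D, #|A|)%:R != 0 :> R by rewrite pnatr_eq0 -lt0n bin_gt0.
  have c2 : 'C(D.+1, #|A|)%:R != 0 :> R by rewrite pnatr_eq0 -lt0n bin_gt0 ltnW.
  have -> : (D.+1 - #|A|)%:R = D.+1%:R * 'C(D, #|A|)%:R / 'C(D.+1, #|A|)%:R :> R.
    by rewrite h' mulfK.
  by field; rewrite c1 c2 nat1r pnatr_eq0.
rewrite E.
have cYi i : i \in Y -> #|Y :\ i| == D.
  by move=> iY; have := cardsD1 i Y; rewrite iY (eqP eD) => -[->].
have hwi i j : i \in Y -> j \in Y :\ i -> 1 <= w j.
  by move=> _ /setD1P[_]; exact: hw.
have avgle (c : R) : (forall i, i \in Y -> \sum_(A : {set T} | (A \subset Y :\ i) && win A)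
     ('C(#|Y :\ i|, #|A|)%:R)^-1 <= c) -> D.+1%:R^-1 * \sum_(i in Y) \sum_(A : {set T} | (A \subset Y :\ i) && win A)
     ('C(#|Y :\ i|, #|A|)%:R)^-1 <= c :> R.
  move=> h; rewrite ler_pdivrMl //; apply: le_trans (ler_sum _ h) _.
  by rewrite sumr_const (eqP eD) mulr_natl.
case wY: (win Y) => /=; last first.
  rewrite add0r; apply: avgle => i iY; apply: IH; [exact: cYi|by move=> j; exact: hwi|lra].
rewrite addrC lerD2r; apply: avgle => i iY.
have h := IH (Y :\ i) (g - 1) (cYi i iY) (fun j => hwi i j iY).
apply: le_trans (_ : (g - 1) + 1 <= g); last by lra.
apply: le_trans (h _); last by lra.
rewrite [leRHS]big_mkcond [leLHS]big_mkcond; apply: ler_sum => A _.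
case: ifP => [/andP[sA /andP[w1 w2]]|_]; last by case: ifP => // _; rewrite invr_ge0.
rewrite ifT // sA w1 /=.
have wi := hw i iY.
have : \sum_(j in A) w j <= \sum_(j in Y :\ i) w j.
  rewrite [leRHS](big_setID A) /= (setIidPr sA) lerDl; apply: sumr_ge0 => j /setDP[jY _].
  by apply: le_trans (hwi i j iY jY).
move: wY; rewrite /win (big_setD1 i iY) /= => /andP[_]; lra.
Qed.

(** By [bin_sqr_bound] every weight in [lym_window] is at least sqrt(#|Y|) / 2^#|Y|, so the weighted
    bound becomes a count. *)
Lemma window_count (Y : {set T}) (g z : R) : (0 < #|Y|)%N ->
  (forall i, i \in Y -> 1 <= w i) -> 0 <= g ->
  #|[set A : {set T} | (A \subset Y) && (z < \sum_(i in A) w i < z + g)]|%:R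
    <= (g + 1) * 2 ^+ #|Y| / Num.sqrt #|Y|%:R.
Proof.
move=> Y0 hw hg.
set F := [set A : {set T} | _].
have sY : 0 < Num.sqrt #|Y|%:R :> R by rewrite sqrtr_gt0 ltr0n.
have pY : 0 < 2 ^+ #|Y| :> R by apply: exprn_gt0.
have key : #|F|%:R * (Num.sqrt #|Y|%:R / 2 ^+ #|Y|) <= g + 1.
  have hg' : -1 <= g by lra.
  apply: le_trans (lym_window z hw hg').
  rewrite mulr_natl -sumr_const big_set; apply: ler_sum => A /andP[sA _].
  have b0 : (0 : R) < 'C(#|Y|, #|A|)%:R by rewrite ltr0n bin_gt0 subset_leq_card.
  rewrite -[leRHS]mul1r ler_pdivlMr // mulrAC ler_pdivrMr // mul1r.
  rewrite -(@ler_pXn2r _ 2) ?nnegrE ?mulr_ge0 ?(ltW pY) ?(ltW b0) ?(ltW sY) //.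
  rewrite exprMn sqr_sqrtr // -exprM mulnC exprM -[2 ^+ 2]/(2 * 2) -natrM -!natrX -natrM ler_nat mulnC.
  exact: bin_sqr_bound.
rewrite ler_pdivlMr // -ler_pdivrMr // -mulrA.
exact: key.
Qed.

End LYM.

(** * Averages over a uniform row of signs *)

Section Averages.
Variables (R : realType) (T : finType).
Implicit Types (F G : {set T} -> R) (a : {set T}).

(* A row of signs is the set of its positions of +1. *)
Definition avg (F : {set T} -> R) : R := (\sum_(a : {set T}) F a) / 2 ^+ #|T|.

Lemma card_set_type : #|{set T}| = (2 ^ #|T|)%N.
Proof. by have := card_powerset [set: T]; rewrite powersetT !cardsT. Qed.

Lemma avg_cst (c : R) : avg (fun=> c) = c.
Proof.
rewrite /avg sumr_const card_set_type -[c *+ _]mulr_natr natrX mulfK //.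
Qed.

Lemma ler_avg F G : (forall a, F a <= G a) -> avg F <= avg G.
Proof.
move=> h; rewrite /avg ler_pM2r ?invr_gt0 ?exprn_gt0 //.
by apply: ler_sum => a _.
Qed.

Lemma avg_ge0 F : (forall a, 0 <= F a) -> 0 <= avg F.
Proof. by move=> h; rewrite -(avg_cst 0); apply: ler_avg. Qed.

Lemma avgD F G : avg (fun a => F a + G a) = avg F + avg G.
Proof. by rewrite /avg big_split mulrDl. Qed.

Lemma avgZ (c : R) F : avg (fun a => c * F a) = c * avg F.
Proof. by rewrite /avg -mulr_sumr mulrA. Qed.

Lemma eq_avg F G : F =1 G -> avg F = avg G.
Proof. by move=> h; congr (_ / _); apply: eq_bigr. Qed.

Lemma avg_sum (I : finType) (P : pred I) (F : I -> {set T} -> R) :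
  avg (fun a => \sum_(i | P i) F i a) = \sum_(i | P i) avg (F i).
Proof. by rewrite /avg exchange_big /= mulr_suml. Qed.

Lemma avg_markov (c : R) F : 0 < c -> (forall a, 0 <= F a) ->
  avg (fun a => (c < F a)%R%:R) <= avg F / c.
Proof.
move=> c0 h; rewrite mulrC -avgZ; apply: ler_avg => a.
case: ltP => cF /=; last by rewrite mulr_ge0 // invr_ge0 ltW.
by rewrite ler_pdivlMl // mulr1 ltW.
Qed.

Definition sgn a (j : T) : R := if j \in a then 1 else -1.

Definition flip a (j : T) : {set T} := [set i | (i \in a) (+) (i == j)].

Lemma flipK j : involutive (flip ^~ j).
Proof. by move=> a; apply/setP => i; rewrite !inE -addbA addbb addbF. Qed.

Lemma avg_flip j F : avg (fun a => F (flip a j)) = avg F.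
Proof.
rewrite /avg; congr (_ / _); rewrite [RHS](reindex_inj (inv_inj (flipK j))).
by [].
Qed.

(* Averaging over the flip of the sign at j decouples the j-th factor. *)
Lemma flip_moment (J : {set T}) (r : T -> {set T} -> bool) (lam : R) :
  0 <= lam <= 1 ->
  (forall j a, j \in J -> r j a || r j (flip a j)) ->
  (forall i j a, i \in J -> j \in J -> i != j -> r i (flip a j) = r i a) ->
  avg (fun a => \prod_(j in J) (if r j a then lam else 1)) <= ((1 + lam) / 2) ^+ #|J|.
Proof.
move=> /andP[l0 l1]; have [m] := ubnP #|J|; elim: m J => // m IH J /ltnSE hm h1 h2.
have [->|[j jJ]] := set_0Vmem J.
  under eq_avg do rewrite big_set0.
  by rewrite avg_cst cards0 expr0.
pose G a := \prod_(i in J :\ j) (if r i a then lam else 1).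
have G0 a : 0 <= G a by apply: prodr_ge0 => i _; case: ifP.
have Gf a : G (flip a j) = G a.
  by apply: eq_bigr => i /setD1P[ij iJ]; rewrite h2.
have E : avg (fun a => \prod_(i in J) (if r i a then lam else 1)) =
    avg (fun a => 2^-1 * (((if r j a then lam else 1) + (if r j (flip a j) then lam else 1)) * G a)).
  rewrite avgZ.
  transitivity (avg (fun a => (if r j a then lam else 1) * G a)).
    by apply: eq_avg => a; rewrite (big_setD1 j).
  set X := avg _.
  have X2 : avg (fun a => (if r j (flip a j) then lam else 1) * G a) = X.
    by rewrite -[RHS](avg_flip j); apply: eq_avg => a; rewrite Gf.
  under [in RHS]eq_avg do rewrite mulrDl.
  by rewrite avgD X2 -/X; field.
have cJ : #|J| = #|J :\ j|.+1 by rewrite (cardsD1 j J) jJ.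
rewrite E cJ exprS; apply: le_trans (_ : (1 + lam) / 2 * avg G <= _).
  rewrite -avgZ; apply: ler_avg => a; rewrite mulrA ler_wpM2r //.
  by have := h1 j a jJ; case: (r j a); case: (r j (flip a j)) => //= _; lra.
rewrite ler_pM2l; last by lra.
apply: IH.
- by rewrite -ltnS -cJ.
- by move=> i a /setD1P[_]; exact: h1.
- by move=> i k a /setD1P[_ iJ] /setD1P[_]; exact: h2.
Qed.

Lemma flip_half (j : T) (r : {set T} -> bool) :
  (forall a, r a || r (flip a j)) -> avg (fun a => (~~ r a)%:R) <= 2^-1.
Proof.
(* With lam = 0 and a single index the product is the indicator that [r] fails. *)
move=> h; have := @flip_moment [set j] (fun _ => r) 0.
rewrite cards1 expr1 addr0 div1r => H.
apply: le_trans (H _ _ _).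
- by apply: ler_avg => a; rewrite big_set1; case: (r a).
- by rewrite lexx ler01.
- by move=> i a /set1P ->.
- by move=> i k a /set1P -> /set1P ->; rewrite eqxx.
Qed.

(* Markov applied to the mean of mu^(4 X) with mu = 2/3: 97/108 = (1 + mu^4) / (2 mu). *)
Lemma flip_quarter (J : {set T}) (r : T -> {set T} -> bool) :
  (forall j a, j \in J -> r j a || r j (flip a j)) ->
  (forall i j a, i \in J -> j \in J -> i != j -> r i (flip a j) = r i a) ->
  avg (fun a => (4 * #|[set j in J | r j a]| < #|J|)%:R) <= (97 / 108) ^+ #|J|.
Proof.
move=> h1 h2; have lam01 : 0 <= ((2 / 3) ^+ 4 : R) <= 1 by apply/andP; split; lra.
have := flip_moment lam01 h1 h2; set M := avg _ => hM.
have c0 : 0 < ((2 / 3) ^+ #|J| : R) by apply: exprn_gt0; lra.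
apply: le_trans (_ : M / (2 / 3) ^+ #|J| <= _); last first.
  rewrite ler_pdivrMr // -exprMn; apply: le_trans hM _.
  by apply: lerXn2r; rewrite ?nnegrE; lra.
rewrite mulrC /M -avgZ; apply: ler_avg => a.
have p0 : 0 <= \prod_(j in J) (if r j a then (2 / 3) ^+ 4 else 1 : R).
  by apply: prodr_ge0 => j _; case: ifP => _; lra.
case: ltnP => hX /=; last by rewrite mulr_ge0 // invr_ge0 ltW.
rewrite ler_pdivlMl // mulr1 -big_mkcondr /= prodr_const -exprM.
have -> : #|[pred i in J | r i a]| = #|[set j in J | r j a]|.
  by apply: eq_card => i; rewrite !inE.
by apply: ler_wiXn2l; [lra|lra|exact: ltnW].
Qed.

(** Fix the signs outside the set [G] of large coefficients. The rest of the sum depends only on the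
    set [pos a] of positive terms, and the event confines the weight of [pos a] to an open window of
    length g, where the weights |v j| / L are at least 1. *)
Lemma littlewood_offord (v : T -> R) (L g t : R) : 0 < L -> 0 <= g -> 0 < t ->
  t <= #|[set j | L <= `|v j|]|%:R ->
  avg (fun a => (`|\sum_j sgn a j * v j| < g * L)%R%:R) <= (g + 1) / Num.sqrt t.
Proof.
move=> L0 g0 t0; set G := [set j | _] => tG.
have GE j : (j \in G) = (L <= `|v j|) by rewrite inE.
clearbody G.
have G0 : (0 < #|G|)%N by rewrite -(ltr0n R); apply: lt_le_trans tG.
have sG : 0 < Num.sqrt #|G|%:R :> R by rewrite sqrtr_gt0 ltr0n.
have st : 0 < Num.sqrt t :> R by rewrite sqrtr_gt0.
apply: le_trans (_ : (g + 1) / Num.sqrt #|G|%:R <= _); last first.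
  rewrite ler_pM2l; last by lra.
  by rewrite lef_pV2 ?posrE // ler_wsqrtr.
pose w j := `|v j| / L.
have w1 j : j \in G -> 1 <= w j by rewrite GE /w ler_pdivlMr // mul1r.
pose pos a := [set j in G | (j \in a) == (0 < v j)].
have sumE a : \sum_j sgn a j * v j = \sum_(j in ~: G) sgn (a :\: G) j * v j
    - L * \sum_(j in G) w j + 2 * L * \sum_(j in pos a) w j.
  rewrite (bigID (mem (~: G))) /= -addrA; congr (_ + _).
    by apply: eq_bigr => j; rewrite in_setC /sgn in_setD => ->.
  rewrite [\sum_(j in pos a) _]big_mkcond /= [X in 2 * L * X](bigID (mem G)) /= addrC.
  rewrite [X in 2 * L * (_ + X)]big1 ?addr0 => [|j /negbTE]; last by rewrite inE => ->.
  rewrite !mulr_sumr -sumrB; apply: eq_big => [j|j]; first by rewrite in_setC negbK.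
  rewrite in_setC negbK => jG; rewrite inE jG /= /sgn /w.
  have vL : L <= `|v j| by rewrite -GE.
  have [v0|v0] := ltP 0 (v j).
    rewrite gtr0_norm //; case: (j \in a) => /=; rewrite ?mulr0; field; lra.
  rewrite ler0_norm //; case: (j \in a) => /=; rewrite ?mulr0; field; lra.
have fibre (S : {set T}) : \sum_(a | a :\: G == S) (`|\sum_j sgn a j * v j| < g * L)%R%:R
    <= (g + 1) * 2 ^+ #|G| / Num.sqrt #|G|%:R.
  pose x1 := \sum_(j in ~: G) sgn S j * v j.
  pose W := \sum_(j in G) w j.
  pose z := (W - x1 / L - g) / 2.
  apply: le_trans (window_count z G0 w1 g0).
  rewrite -natr_sum ler_nat -big_mkcondr /= sum1_card.
  pose Q := [set a | (a :\: G == S) && (`|\sum_j sgn a j * v j| < g * L)].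
  have -> : #|[pred a | (a :\: G == S) & (`|\sum_j sgn a j * v j| < g * L)]| = #|Q|.
    by apply: eq_card => a; rewrite !inE.
  have inj : {in Q &, injective pos}.
    move=> a b; rewrite !inE => /andP[/eqP ea _] /andP[/eqP eb _] eab.
    apply/setP => j; have [jG|jG] := boolP (j \in G).
      have := congr1 (fun X : {set T} => j \in X) eab; rewrite !inE jG /=.
      by case: (j \in a); case: (j \in b); case: (0 < v j).
    have : (j \in a :\: G) = (j \in b :\: G) by rewrite ea eb.
    by rewrite !in_setD jG.
  rewrite -(card_in_imset inj); apply: subset_leq_card; apply/subsetP => A /imsetP[a aQ ->].
  have /andP[/eqP ea hn] : (a :\: G == S) && (`|\sum_j sgn a j * v j| < g * L) by move: aQ; rewrite inE.
  rewrite sumE ea -/x1 -/W in hn.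
  rewrite inE; apply/andP; split; first by apply/subsetP => j; rewrite inE => /andP[].
  move: hn; set s := \sum_(i in pos a) w i; rewrite ltr_norml => /andP[h1 h2].
  have e1 : x1 = (x1 / L) * L by rewrite divfK // gt_eqF.
  move: h1 h2; rewrite e1 /z; set y := x1 / L => h1 h2.
  have h1' : - g < y - W + 2 * s by rewrite -(ltr_pM2r L0); lra.
  have h2' : y - W + 2 * s < g by rewrite -(ltr_pM2r L0); lra.
  by apply/andP; split; lra.
rewrite /avg (partition_big (fun a => a :\: G) (fun S : {set T} => S \subset ~: G)) /=; last first.
  by move=> a _; rewrite setDE subsetIr.
rewrite ler_pdivrMr ?exprn_gt0 //.
apply: le_trans (ler_sum _ (fun S _ => fibre S)) _.
have -> : \sum_(S : {set T} | S \subset ~: G) (g + 1) * 2 ^+ #|G| / Num.sqrt #|G|%:R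
   = (2 ^ #|~: G|)%:R * ((g + 1) * 2 ^+ #|G| / Num.sqrt #|G|%:R).
  rewrite sumr_const -card_powerset mulr_natl; congr (_ *+ _).
  by apply: eq_card => S; rewrite inE.
have -> : 2 ^+ #|T| = 2 ^+ #|~: G| * 2 ^+ #|G| :> R.
  by rewrite -exprD addnC cardsC.
by rewrite natrX le_eqVlt; apply/orP; left; apply/eqP; field; rewrite gt_eqF.
Qed.

End Averages.
(** * Entropy bound for the shadow of a uniform family *)

Lemma ln_le_subr1 (R : realType) (x : R) : 0 < x -> ln x <= x - 1.
Proof.
by move=> x0; have := @le_ln1Dx _ (x - 1); rewrite (_ : 1 + (x - 1) = x); [apply; lra|ring].
Qed.

Section Entropy.
Variables (R : realType) (T : finType) (s : nat) (F : {set {set T}}).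
Hypothesis Fs : forall B, B \in F -> #|B| = s.

Definition deg (C : {set T}) : nat := #|[set i | (i \notin C) && (i |: C \in F)]|.

Definition above (V : {set T}) : {set {set T}} := [set B in F | V \subset B].

Lemma sum_above r (V : {set T}) : (#|V| + r = s)%N ->
  (\sum_(B in above V) #|B :\: V| = r * #|above V|)%N.
Proof.
move=> hr; rewrite (eq_bigr (fun=> r)) ?sum_nat_const 1?mulnC // => B.
by rewrite inE => /andP[BF VB]; rewrite cardsD (setIidPr VB) (Fs BF) -hr addKn.
Qed.

Lemma above_flags (V : {set T}) :
  (\sum_(v in ~: V) #|above (v |: V)| = \sum_(B in above V) #|B :\: V|)%N.
Proof.
under eq_bigr do rewrite -sum1_card.
rewrite (exchange_big_dep (fun B => B \in above V)) /=; last first.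
  by move=> v B _; rewrite !inE subUset => /and3P[-> _ ->].
apply: eq_bigr => B; rewrite inE => /andP[BF VB]; rewrite sum1_card; apply: eq_card => v.
by rewrite unfold_in /= !inE subUset sub1set BF VB andbT.
Qed.

(** The map (B, i) -> (i |: B :\ v, i) injects the pairs counted on the left into the pairs of a
    member above [V] and one of its r elements outside [V]. *)
Lemma deg_above r (V : {set T}) (v : T) : (#|V| + r = s)%N -> v \notin V ->
  (\sum_(B in above (v |: V)) deg (B :\ v) <= r * #|above V|)%N.
Proof.
move=> hr vV; rewrite -(sum_above hr).
pose P1 := [set p : {set T} * T | (p.1 \in above (v |: V)) &&
   ((p.2 \notin p.1 :\ v) && (p.2 |: p.1 :\ v \in F))].
pose P2 := [set p : {set T} * T | (p.1 \in above V) && (p.2 \in p.1 :\: V)].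
have -> : (\sum_(B in above (v |: V)) deg (B :\ v) = #|P1|)%N.
  rewrite -sum1_card /deg; under eq_bigr do rewrite -sum1_card.
  by rewrite pair_big_dep /=; apply: eq_bigl => p; rewrite /P1 !inE.
have -> : (\sum_(B in above V) #|B :\: V| = #|P2|)%N.
  rewrite -sum1_card; under eq_bigr do rewrite -sum1_card.
  by rewrite pair_big_dep /=; apply: eq_bigl => p; rewrite /P2 !inE.
pose h (p : {set T} * T) := (p.2 |: p.1 :\ v, p.2).
have inj : {in P1 &, injective h}.
  move=> [B i] [B' i']; rewrite !inE /= => /and3P[/andP[_ vB] iB _] /and3P[/andP[_ vB'] iB' _].
  rewrite /h /= => -[e ei]; rewrite -ei in e iB' *; congr (_, _).
  move: vB vB'; rewrite !subUset !sub1set => /andP[vB _] /andP[vB' _].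
  rewrite -(setD1K vB) -(setD1K vB').
  have iB1 : i \notin B :\ v by rewrite !inE.
  have iB1' : i \notin B' :\ v by rewrite !inE.
  by rewrite -(setU1K iB1) -(setU1K iB1') e.
rewrite -(card_in_imset inj); apply: subset_leq_card; apply/subsetP => p /imsetP[[B i]].
rewrite inE /= => /and3P[hB iB iF] ->; rewrite /h inE /=.
move: hB; rewrite inE subUset => /and3P[_ _ VB].
have VBv : V \subset B :\ v by rewrite subsetD1 VB.
rewrite inE iF /= (subset_trans VBv (subsetUr _ _)) /= in_setD setU11 andbT.
by apply: contraNN iB => iV; exact: (subsetP VBv).
Qed.

(* Han's inequality for the family F, by revealing the elements of a random B one
   at a time: V is the revealed part, and deg is always taken in the whole of F. *)
Lemma entropy_above r (V : {set T}) : (#|V| + r = s)%N ->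
  \sum_(B in above V) \sum_(j in B :\: V) ln (deg (B :\ j))%:R
    <= #|above V|%:R * ln ((r`! * #|above V|)%:R) :> R.
Proof.
elim: r V => [|r IH] V hr.
  rewrite big1 => [|B]; last first.
    rewrite inE => /andP[BF VB].
    have -> : B :\: V = set0; last by rewrite big_set0.
    by apply/eqP; rewrite -cards_eq0 cardsD (setIidPr VB) (Fs BF) -hr addn0 subnn.
  rewrite mul1n; case: #|above V| => [|k]; first by rewrite mul0r.
  by rewrite mulr_ge0 // ln_ge0 // ler1n.
have [e0|N0] := posnP #|above V|.
  rewrite e0 mul0r big1 // => B BV; move/eqP: e0; rewrite cards_eq0 => /eqP e0.
  by rewrite e0 inE in BV.
set N := #|above V|; set Lam := \sum_(B in _) _; pose K : R := (r.+1`! * N)%:R.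
pose Nv v := #|above (v |: V)|.
have N0R : (0 : R) < N%:R by rewrite ltr0n.
have aboveU v B : (B \in above (v |: V)) = (B \in above V) && (v \in B).
  by rewrite !inE subUset sub1set andbA andbAC.
(* Induction for each next revealed element v: a flag (B, j) occurs once for each of the r
   unrevealed elements of B other than j. *)
have h1 : r%:R * Lam <= \sum_(v in ~: V) (Nv v)%:R * ln ((r`! * Nv v)%:R).
  have IHv v : v \in ~: V -> \sum_(B in above (v |: V)) \sum_(j in B :\: (v |: V))
      ln (deg (B :\ j))%:R <= (Nv v)%:R * ln ((r`! * Nv v)%:R) :> R.
    by rewrite inE => vV; apply: IH; rewrite cardsU1 vV add1n addSnnS.
  apply: le_trans (ler_sum _ IHv).
  rewrite (exchange_big_dep (fun B => B \in above V)) /=; last first.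
    by move=> v B _; rewrite aboveU => /andP[].
  rewrite /Lam mulr_sumr; apply: ler_sum => B BV.
  have /andP[BF VB] : (B \in F) && (V \subset B) by move: BV; rewrite inE.
  rewrite (exchange_big_dep (fun j => j \in B :\: V)) /=; last first.
    by move=> v j _; rewrite !inE negb_or -andbA => /and3P[_ -> ->].
  rewrite mulr_sumr; apply: ler_sum => j jBV; rewrite sumr_const -[leRHS]mulr_natl.
  rewrite (_ : #|_| = r) //.
    have -> : r = #|(B :\: V) :\ j|.
      have := cardsD1 j (B :\: V); rewrite jBV cardsD (setIidPr VB) (Fs BF) -hr addKn.
      by case.
    apply: eq_card => v; rewrite unfold_in /= aboveU BV !inE /=.
    move: jBV; rewrite !inE => /andP[jV jB]; rewrite jB andbT negb_or jV andbT eq_sym.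
    by case: (v \in V); case: (v \in B); rewrite ?andbF ?andbT.
(* The remaining flags are those with v = j. Here ln x <= x - 1 is used at x = (Nv / c) deg, and by
   [deg_above] the linear bounds sum to at most 0. *)
have h2 : \sum_(v in ~: V) \sum_(B in above (v |: V))
    (ln ((r`! * Nv v)%:R) + ln (deg (B :\ v))%:R - ln K) <= 0.
  pose c : R := (r.+1 * N)%:R.
  have c0 : 0 < c by rewrite /c ltr0n muln_gt0 /=.
  apply: le_trans (_ : \sum_(v in ~: V) \sum_(B in above (v |: V))
     ((Nv v)%:R / c * (deg (B :\ v))%:R - 1) <= _).
    apply: ler_sum => v vV; apply: ler_sum => B BV.
    have nv0 : (0 < Nv v)%N by apply/card_gt0P; exists B.
    have /andP[BF] : (B \in F) && (v |: V \subset B) by move: BV; rewrite inE.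
    rewrite subUset sub1set => /andP[vB _].
    have d0 : (0 < deg (B :\ v))%N.
      by apply/card_gt0P; exists v; rewrite inE setD11 /= setD1K.
    have x0 : (0 : R) < (r`! * Nv v)%:R by rewrite ltr0n muln_gt0 fact_gt0.
    have y0 : (0 : R) < (deg (B :\ v))%:R by rewrite ltr0n.
    have K0 : 0 < K by rewrite /K ltr0n muln_gt0 fact_gt0.
    rewrite -lnM ?posrE // -ln_div ?posrE ?mulr_gt0 //.
    have -> : (Nv v)%:R / c * (deg (B :\ v))%:R = (r`! * Nv v)%:R * (deg (B :\ v))%:R / K.
      rewrite /c /K factS !natrM; field.
      by rewrite gt_eqF // pnatr_eq0 -lt0n fact_gt0 nat1r pnatr_eq0.
    by apply: ln_le_subr1; rewrite divr_gt0 ?mulr_gt0.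
  have cN : \sum_(v in ~: V) (Nv v)%:R = c.
    by rewrite -natr_sum above_flags (sum_above hr).
  apply: le_trans (_ : \sum_(v in ~: V) ((Nv v)%:R / c * c - (Nv v)%:R) <= _).
    apply: ler_sum => v; rewrite inE => vV.
    rewrite sumrB -mulr_sumr sumr_const lerD2r ler_wpM2l //.
      by rewrite divr_ge0 // ltW.
    by rewrite -natr_sum ler_nat; exact: deg_above.
  rewrite big1 // => v _; rewrite divfK ?subrr // gt_eqF //.
have h3 : \sum_(v in ~: V) \sum_(B in above (v |: V))
    (ln ((r`! * Nv v)%:R) + ln (deg (B :\ v))%:R - ln K) =
    \sum_(v in ~: V) (Nv v)%:R * ln ((r`! * Nv v)%:R) + Lam - (r.+1 * N)%:R * ln K.
  have -> : Lam = \sum_(v in ~: V) \sum_(B in above (v |: V)) ln (deg (B :\ v))%:R.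
    rewrite [RHS](exchange_big_dep (fun B => B \in above V)) /=; last first.
      by move=> v B _; rewrite aboveU => /andP[].
    apply: eq_bigr => B BV; apply: eq_bigl => v; rewrite aboveU BV !inE /=.
    by [].
  rewrite -(sum_above hr) -above_flags natr_sum mulr_suml -big_split -sumrB /=.
  apply: eq_bigr => v _; rewrite sumrB big_split /= !sumr_const.
  by rewrite !mulr_natl.
rewrite -/N -/K.
have : (r.+1 * N)%:R * ln K = r.+1%:R * (N%:R * ln K) by rewrite natrM mulrA.
move: h2; rewrite h3 => h2 e; rewrite e in h2.
have : r.+1%:R * Lam <= r.+1%:R * (N%:R * ln K).
  by rewrite -[r.+1%:R in X in X <= _]natr1 mulrDl mul1r; lra.
by rewrite ler_pM2l // ltr0n.
Qed.

Lemma sum_shadow (f : {set T} -> R) :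
  \sum_(B in F) \sum_(j in B) f (B :\ j) = \sum_C (deg C)%:R * f C.
Proof.
rewrite (eq_bigr (fun B : {set T} => \sum_(j | j \in B) \sum_(C | C == B :\ j) f C)); last first.
  by move=> B _; apply: eq_bigr => j _; rewrite big_pred1_eq.
transitivity (\sum_(B in F) \sum_C \sum_(j | (j \in B) && (C == B :\ j)) f C).
  by apply: eq_bigr => B _; rewrite (exchange_big_dep xpredT).
rewrite exchange_big /=; apply: eq_bigr => C _.
rewrite (exchange_big_dep xpredT) //=.
transitivity (\sum_(j | (j \notin C) && (j |: C \in F)) f C); last first.
  rewrite sumr_const mulr_natl; congr (_ *+ _).
  by apply: eq_card => i; rewrite inE.
rewrite [RHS]big_mkcond; apply: eq_bigr => j _.
case: ifP => [/andP[jC jF]|/negbT h].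
  rewrite (eq_bigl (pred1 (j |: C))) ?big_pred1_eq // => B /=.
  apply/idP/idP => [/andP[_ /andP[jB /eqP ->]]|/eqP ->]; first by rewrite setD1K.
  by rewrite jF setU11 setU1K /=.
rewrite big_pred0 // => B; apply: contraNF h => /andP[BF /andP[jB /eqP ->]].
by rewrite setD11 setD1K.
Qed.

Lemma sum_deg : \sum_C (deg C)%:R = (#|F| * s)%:R :> R.
Proof.
rewrite (eq_bigr (fun C => (deg C)%:R * 1)) => [|C _]; last by rewrite mulr1.
rewrite -(sum_shadow (fun=> 1)) (eq_bigr (fun=> s%:R)) => [|B BF].
  by rewrite natrM mulr_natl sumr_const.
by rewrite sumr_const (Fs BF).
Qed.

Lemma entropy_deg :
  \sum_C (deg C)%:R * ln (deg C)%:R <= #|F|%:R * ln ((s`! * #|F|)%:R) :> R.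
Proof.
have := @entropy_above s set0; rewrite cards0 add0n => /(_ erefl).
have -> : above set0 = F by apply/setP => B; rewrite inE sub0set andbT.
rewrite (eq_bigr (fun B : {set T} => \sum_(j in B) ln (deg (B :\ j))%:R)).
  by rewrite (sum_shadow (fun C => ln (deg C)%:R)).
by move=> B _; apply: eq_bigl => j; rewrite setD0.
Qed.

(* Weighted Jensen (ln u <= u - 1) on top of [entropy_deg]. *)
Lemma shadow_lower_bound (S : {set {set T}}) (W : R) : 0 < W ->
  W <= \sum_(C in S) (deg C)%:R ->
  ln W - #|F|%:R / W * ln ((s`! * #|F|)%:R) <= ln #|S|%:R :> R.
Proof.
move=> W0 hW; set W' := \sum_(C in S) _ in hW; set lM := ln (_ * _)%:R.
have lM0 : 0 <= lM.
  rewrite /lM; case: (s`! * #|F|)%N => [|k]; first by rewrite ln0.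
  by rewrite ln_ge0 // ler1n.
have W'0 : 0 < W' by exact: lt_le_trans hW.
(* Shadows of degree 0 carry no mass; without them every logarithm below is that of a positive
   number. *)
pose S' := [set C in S | (0 < deg C)%N].
have W'E : W' = \sum_(C in S') (deg C)%:R.
  rewrite /W' (bigID (fun C => (0 < deg C)%N)) /= [X in _ + X]big1 ?addr0 => [|C].
    by apply: eq_bigl => C; rewrite inE.
  by rewrite -eqn0Ngt => /andP[_ /eqP ->].
have S'0 : (0 < #|S'|)%N.
  rewrite lt0n; apply/eqP => /eqP; rewrite cards_eq0 => /eqP e.
  by move: W'0; rewrite W'E e big_set0 ltxx.
have S'R : (0 : R) < #|S'|%:R by rewrite ltr0n.
have key : W' * ln (W' / #|S'|%:R) <= #|F|%:R * lM.
  apply: le_trans entropy_deg.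
  apply: (@le_trans _ _ (\sum_(C in S') (deg C)%:R * ln (deg C)%:R)); last first.
    rewrite [leRHS](bigID (fun C => C \in S')) /= lerDl; apply: sumr_ge0 => C _.
    by case: (deg C) => [|k]; rewrite ?mul0r // mulr_ge0 // ln_ge0 // ler1n.
  rewrite {1}W'E mulr_suml -subr_le0 -sumrB.
  apply: (@le_trans _ _ (\sum_(C in S') (W' / #|S'|%:R - (deg C)%:R))).
    apply: ler_sum => C; rewrite inE => /andP[_ d0].
    have dR : (0 : R) < (deg C)%:R by rewrite ltr0n.
    have h := @ln_le_subr1 _ (W' / #|S'|%:R / (deg C)%:R).
    rewrite -mulrBr -ln_div ?posrE ?divr_gt0 //.
    apply: le_trans (_ : (deg C)%:R * (W' / #|S'|%:R / (deg C)%:R - 1) <= _).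
      by rewrite ler_pM2l //; apply: h; rewrite !divr_gt0.
    by rewrite mulrBr mulr1 mulrC divfK // gt_eqF.
  by rewrite sumrB sumr_const -W'E -[_ *+ _]mulr_natr divfK ?subrr // gt_eqF.
rewrite ln_div ?posrE // in key.
have h1 : ln W <= ln W' by rewrite ler_ln ?posrE.
have h2 : #|F|%:R / W' * lM <= #|F|%:R / W * lM.
  by rewrite ler_wpM2r // ler_wpM2l // lef_pV2 ?posrE.
have h3 : ln #|S'|%:R <= ln #|S|%:R :> R.
  have le : (#|S'| <= #|S|)%N by apply: subset_leq_card; apply/subsetP => C; rewrite inE => /andP[].
  by rewrite ler_ln ?posrE // ?ler_nat // ltr0n (leq_trans S'0 le).
have h4 : ln W' - ln #|S'|%:R <= #|F|%:R / W' * lM.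
  by rewrite -mulrA [W'^-1 * _]mulrC mulrA ler_pdivlMr // mulrC.
lra.
Qed.

End Entropy.
(** * Exposing one row *)

Section Process.
Variables (R : realType) (n : nat).
Local Notation state := ({set 'I_n} -> R).
Implicit Types (f : state) (a B C : {set 'I_n}).

(* State after some rows: f C is the permanent of these rows restricted to the
   columns outside C, so #|C| rows remain, and the value at the empty set of the
   last state is the permanent. Exposing a row is the Laplace expansion along it. *)
Definition expose a f : state :=
  fun C => \sum_(j | j \notin C) sgn R a j * f (j |: C).

Definition heavy f (s : nat) (L : R) : {set {set 'I_n}} :=
  [set B : {set 'I_n} | (#|B| == s) && (L <= `|f B|)].

Lemma heavy_card f s L B : B \in heavy f s L -> #|B| = s.
Proof. by rewrite inE => /andP[/eqP]. Qed.

Lemma deg_card f s L C : (0 < deg (heavy f s.+1 L) C)%N -> #|C| = s.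
Proof.
case/card_gt0P => i; rewrite inE => /andP[iC /heavy_card].
by rewrite cardsU1 iC => -[].
Qed.

Lemma expose_flip f C a j : j \in C -> expose (flip a j) f C = expose a f C.
Proof.
move=> jC; apply: eq_bigr => i iC; rewrite /sgn inE.
have /negbTE -> : i != j by apply: contraNneq iC => ->.
by rewrite addbF.
Qed.

(** The two values are x + f B and x - f B up to order, and their absolute values add up to at least
    2 |f B|. *)
Lemma expose_keep f B j a (L : R) : j \in B -> L <= `|f B| ->
  (L <= `|expose a f (B :\ j)|) || (L <= `|expose (flip a j) f (B :\ j)|).
Proof.
move=> jB LB; have jC : j \notin B :\ j by rewrite setD11.
rewrite /expose !(bigD1 j jC) /= setD1K //.
set x := \sum_(i < n | _) _; set y := \sum_(i < n | _) _.
have -> : y = x.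
  apply: eq_bigr => i /andP[_ ij]; congr (_ * _).
  by rewrite /sgn inE (negbTE ij) addbF.
rewrite /sgn inE eqxx addbT; case: (j \in a) => /=; rewrite mul1r mulN1r; apply/orP.
  have [h|h] := leP L `|f B + x|; [by left|right].
  move: h LB; do 3 (case: ger0P => ?); lra.
have [h|h] := leP L `|- f B + x|; [by left|right].
by move: h LB; do 3 (case: ger0P => ?); lra.
Qed.

Lemma expose_half f s L C : (0 < deg (heavy f s L) C)%N ->
  avg (fun a => (`|expose a f C| < L)%R%:R : R) <= 2^-1.
Proof.
case/card_gt0P => i; rewrite inE => /andP[iC]; rewrite inE => /andP[_ Lf].
have := @flip_half R _ i (fun a => L <= `|expose a f C|).
have h a : (L <= `|expose a f C|) || (L <= `|expose (flip a i) f C|).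
  have := @expose_keep f (i |: C) i a L (setU11 _ _) Lf.
  by rewrite setU1K.
by move=> /(_ h); under eq_avg do rewrite -ltNge.
Qed.

(** Littlewood-Offord with coefficients f (j |: C), set to 0 on [C] so that the sum runs over all
    columns. *)
Lemma expose_small_ball f s (L g t : R) C : 0 < L -> 0 <= g -> 0 < t ->
  t <= (deg (heavy f s L) C)%:R ->
  avg (fun a => (`|expose a f C| < g * L)%R%:R) <= (g + 1) / Num.sqrt t.
Proof.
move=> L0 g0 t0 td; pose v j := if j \notin C then f (j |: C) else 0.
have tv : t <= #|[set j | L <= `|v j|]|%:R.
  apply: le_trans td _; rewrite ler_nat; apply: subset_leq_card; apply/subsetP => j.
  rewrite inE => /andP[jC]; rewrite !inE => /andP[_ h].
  by rewrite /v jC.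
apply: le_trans (littlewood_offord L0 g0 t0 tv); apply: ler_avg => a.
rewrite (_ : \sum_j _ = expose a f C) // /expose [RHS]big_mkcond; apply: eq_bigr => j _.
by rewrite /v; case: ifP; rewrite ?mulr0.
Qed.

(** * Flags kept after exposing one row *)

Section OneStep.
Variables (f : state) (s : nat) (L : R).
Hypothesis L0 : 0 < L.
Local Notation F := (heavy f s.+1 L).
Local Notation N := #|F|.
Local Notation d C := ((deg F C)%:R).
Local Notation total := ((N * s.+1)%:R).
Hypothesis N0 : (0 < N)%N.

Lemma total_gt0 : 0 < total :> R.
Proof. by rewrite ltr0n muln_gt0 N0. Qed.

Lemma sum_deg_heavy : \sum_C d C = total :> R.
Proof. by apply: sum_deg => B; exact: heavy_card. Qed.

(** The condition on cardinality comes for free: by [deg_card] a set of positive degree has s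
    elements. *)
Lemma heavy_mass (a : {set 'I_n}) (L' : R) (P : pred {set 'I_n}) :
  \sum_(C in heavy (expose a f) s L' | P C) d C
   = \sum_(C | P C && (L' <= `|expose a f C|)) d C :> R.
Proof.
rewrite big_mkcond [RHS]big_mkcond; apply: eq_bigr => C _; rewrite inE.
have [d0|d0] := posnP (deg F C); first by rewrite d0; do 2 case: ifP.
by rewrite (deg_card d0) eqxx andbC.
Qed.

(** Each shadow of degree at least t fails with probability at most (g + 1) / sqrt t; Markov is
    applied to the mass of the failing ones. *)
Lemma high_loss (g t tau : R) : 0 <= g -> 0 < t -> 0 < tau ->
  avg (fun a => (tau * total < \sum_(C | (t <= d C) && (`|expose a f C| < g * L)) d C)%R%:R)
   <= (g + 1) / Num.sqrt t / tau.
Proof.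
move=> g0 t0 tau0; apply: le_trans (avg_markov _ _) _.
- by rewrite mulr_gt0 ?total_gt0.
- by move=> a; apply: sumr_ge0.
rewrite invfM mulrA mulrAC; rewrite ler_pM2r ?invr_gt0 // ler_pdivrMr ?total_gt0 //.
rewrite (@eq_avg _ _ _ (fun a => \sum_(C | t <= d C) d C * (`|expose a f C| < g * L)%R%:R)); last first.
  move=> a; rewrite big_mkcondr; apply: eq_bigr => C _; case: ifP => _; by rewrite ?mulr1 ?mulr0.
rewrite avg_sum -sum_deg_heavy mulr_sumr [leRHS](bigID (fun C => t <= d C)) /= -[leLHS]addr0.
apply: lerD; last first.
  by apply: sumr_ge0 => C _; rewrite mulr_ge0 // divr_ge0 ?sqrtr_ge0 // addr_ge0.
apply: ler_sum => C tC; rewrite avgZ mulrC ler_wpM2r //.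
exact: (expose_small_ball L0 g0 t0 tC).
Qed.

(** Markov after [expose_half]: 2/3 is the quotient of 1/2 by 3/4. *)
Lemma half_loss (P : pred {set 'I_n}) : 0 < \sum_(C | P C) d C :> R ->
  avg (fun a => (3 / 4 * \sum_(C | P C) d C
        < \sum_(C | P C && (`|expose a f C| < L)) d C :> R)%R%:R) <= 2 / 3 :> R.
Proof.
set m : R := \sum_(C | P C) d C => m0; apply: le_trans (avg_markov _ _) _.
- by rewrite mulr_gt0.
- by move=> a; apply: sumr_ge0.
rewrite ler_pdivrMr; last by rewrite mulr_gt0.
rewrite (@eq_avg _ _ _ (fun a => \sum_(C | P C) d C * (`|expose a f C| < L)%R%:R)); last first.
  move=> a; rewrite big_mkcondr; apply: eq_bigr => C _; case: ifP => _; by rewrite ?mulr1 ?mulr0.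
rewrite avg_sum (_ : 2 / 3 * (3 / 4 * m) = \sum_(C | P C) d C / 2); last first.
  by rewrite -mulr_suml -/m; field.
apply: ler_sum => C _; rewrite avgZ.
have [d0|d0] := posnP (deg F C); first by rewrite d0 !mul0r.
by rewrite ler_wpM2l //; exact: expose_half d0.
Qed.

(** Once the signs outside a heavy B are fixed, the value at B :\ j depends only on the sign at j,
    so the shadows of B survive independently and a B with many flags rarely keeps less than a
    quarter of them. The factor 1/16 is at most 1/2 (mass in rich B) times 1/2 (Markov) times
    1/4. *)
Lemma exp_loss (kap : nat) (r : R) (P : pred {set 'I_n}) :
  (0 < kap)%N -> 0 <= r <= 1 -> 97 / 108 <= r ^+ kap ->
  2 * total <= kap%:R * \sum_(C | P C) d C :> R ->
  avg (fun a => (\sum_(C | P C && (L <= `|expose a f C|)) d C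
         < (\sum_(C | P C) d C) / 16 :> R)%R%:R) <= 2 * r ^+ s.+1.
Proof.
move=> k0 /andP[r0 r1] hr hm; set m : R := \sum_(C | P C) d C in hm *.
have m0 : 0 < m.
  have := total_gt0; have : (0 : R) < kap%:R by rewrite ltr0n.
  by nra.
pose J B := [set j in B | P (B :\ j)].
pose ret B a := #|[set j in J B | L <= `|expose a f (B :\ j)|]|.
have mE : m = \sum_(B in F) #|J B|%:R.
  rewrite /m big_mkcond /= (eq_bigr (fun C => d C * (P C)%:R)); last first.
    by move=> C _; case: (P C); rewrite ?mulr1 ?mulr0.
  rewrite -(@sum_shadow R _ F (fun C => (P C)%:R)); apply: eq_bigr => B _.
  rewrite -natr_sum -big_mkcondr /= sum1_card; congr (_%:R).
  by apply: eq_card => j; rewrite !inE.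
have goodE a : \sum_(C | P C && (L <= `|expose a f C|)) d C = \sum_(B in F) (ret B a)%:R :> R.
  rewrite big_mkcond /= (eq_bigr (fun C => d C * (P C && (L <= `|expose a f C|))%:R)); last first.
    by move=> C _; case: (P C && _); rewrite ?mulr1 ?mulr0.
  rewrite -(@sum_shadow R _ F (fun C => (P C && (L <= `|expose a f C|))%:R)); apply: eq_bigr => B _.
  rewrite -natr_sum -big_mkcondr /= sum1_card; congr (_%:R).
  by apply: eq_card => j; rewrite /ret !inE -andbA.
pose rich B := (s.+1 <= kap * #|J B|)%N.
set M := \sum_(B in F | rich B) #|J B|%:R : R.
(* The members that are not rich carry at most total / kap flags in all, which is at most m / 2. *)
have hM : m / 2 <= M.
  suff : \sum_(B in F | ~~ rich B) #|J B|%:R <= m / 2.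
    by move: mE; rewrite (bigID rich) /= -/M; lra.
  have k0R : (0 : R) < kap%:R by rewrite ltr0n.
  apply: le_trans (_ : \sum_(B in F) s.+1%:R / kap%:R <= _).
    rewrite [leRHS](bigID rich) /= -[leLHS]add0r; apply: lerD.
      by apply: sumr_ge0 => B _; rewrite divr_ge0.
    apply: ler_sum => B /andP[_]; rewrite -ltnNge => h.
    by rewrite ler_pdivlMr // -natrM ler_nat mulnC ltnW.
  rewrite sumr_const -[_ *+ _]mulr_natl mulrA -natrM ler_pdivrMr //.
  by lra.
have M0 : 0 < M by lra.
pose X a := \sum_(B in F | rich B) #|J B|%:R * (4 * ret B a < #|J B|)%N%:R : R.
have X0 a : 0 <= X a by apply: sumr_ge0 => B _; rewrite mulr_ge0.
have avX : avg X <= r ^+ s.+1 * M.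
  rewrite /X avg_sum /M mulr_sumr; apply: ler_sum => B /andP[BF rB].
  rewrite avgZ mulrC ler_wpM2r //.
  have LB : L <= `|f B| by move: BF; rewrite inE => /andP[].
  have h1 j a : j \in J B -> (L <= `|expose a f (B :\ j)|) || (L <= `|expose (flip a j) f (B :\ j)|).
    by rewrite inE => /andP[jB _]; exact: expose_keep.
  have h2 i j a : i \in J B -> j \in J B -> i != j ->
      (L <= `|expose (flip a j) f (B :\ i)|) = (L <= `|expose a f (B :\ i)|).
    rewrite !inE => /andP[iB _] /andP[jB _] ij; rewrite expose_flip //.
    by rewrite !inE eq_sym ij.
  apply: le_trans (@flip_quarter R _ (J B) (fun j a => L <= `|expose a f (B :\ j)|) h1 h2) _.
  apply: le_trans (_ : (r ^+ kap) ^+ #|J B| <= _).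
    by apply: lerXn2r; rewrite ?nnegrE ?exprn_ge0 //; lra.
  by rewrite -exprM; apply: ler_wiXn2l.
apply: le_trans (_ : avg (fun a => (M / 2 < X a)%R%:R) <= _).
  apply: ler_avg => a; rewrite goodE; case: ltP => [h|//].
  suff -> : M / 2 < X a by [].
  have : (M - X a) / 4 <= \sum_(B in F) (ret B a)%:R.
    apply: le_trans (_ : \sum_(B in F | rich B) (ret B a)%:R <= _); last first.
      by rewrite [leRHS](bigID rich) /= lerDl sumr_ge0.
    rewrite /M /X -sumrB mulr_suml; apply: ler_sum => B _.
    case: ltnP => /= hB; first by rewrite mulr1 subrr mul0r.
    rewrite mulr0 subr0 ler_pdivrMr // mulrC -natrM ler_nat.
    exact: hB.
  by lra.
apply: le_trans (avg_markov _ X0) _; first by lra.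
rewrite ler_pdivrMr; last by lra.
by lra.
Qed.

End OneStep.

(* The family has n ^ (s * density) ordered members: a single set of size
   proportional to n already has density 1 - O(1 / ln n). Empty families get 0,
   since [ln 0 = 0]. *)
Definition density f (s : nat) (L : R) : R :=
  ln ((s`! * #|heavy f s L|)%:R) / (s%:R * ln n%:R).

Local Notation ell := (@ln R n%:R).

Lemma leq_ffact_exp (m k : nat) : (m ^_ k <= m ^ k)%N.
Proof.
elim: k => [|k IH] //; rewrite ffactnSr expnSr leq_mul //; exact: leq_subr.
Qed.

Lemma card_heavy f s L : (s`! * #|heavy f s L| <= n ^ s)%N.
Proof.
apply: leq_trans (leq_ffact_exp n s); rewrite -bin_ffact mulnC leq_mul2r; apply/orP; right.
rewrite -[n in 'C(n, _)]card_ord -card_draws; apply: subset_leq_card.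
by apply/subsetP => B; rewrite !inE => /andP[].
Qed.

Lemma ln_nat_ge0 (m : nat) : 0 <= ln m%:R :> R.
Proof. by case: m => [|m]; [rewrite ln0|rewrite ln_ge0 // ler1n]. Qed.

Lemma density_ge0 f s L : 0 <= density f s L.
Proof. by rewrite divr_ge0 ?mulr_ge0 ?ln_nat_ge0. Qed.

Lemma densityE f s L : (0 < s)%N -> 0 < ell ->
  ln ((s`! * #|heavy f s L|)%:R) = s%:R * ell * density f s L.
Proof.
move=> s0 l0; rewrite /density mulrC divfK // mulf_neq0 ?gt_eqF // ltr0n.
by [].
Qed.

Lemma density_le1 f s L : (0 < s)%N -> 0 < ell -> density f s L <= 1.
Proof.
move=> s0 l0; rewrite ler_pdivrMr ?mulr_gt0 ?ltr0n // mul1r.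
have [->|N0] := posnP (s`! * #|heavy f s L|)%N.
  by rewrite ln0 // mulr_ge0 // ltW.
have n0 : (0 < n)%N by case: n l0 => //; rewrite ln0 // ltxx.
rewrite mulr_natl -lnXn ?ltr0n // ler_ln ?posrE ?exprn_gt0 ?ltr0n //.
by rewrite -natrX ler_nat card_heavy.
Qed.

(** * Change of the density in one step *)

Section DensityStep.
Variables (f f' : state) (s : nat) (L L' : R).
Hypotheses (s0 : (0 < s)%N) (l1 : 1 <= ell) (N0 : (0 < #|heavy f s.+1 L|)%N).
Local Notation F := (heavy f s.+1 L).
Local Notation d C := ((deg F C)%:R).
Local Notation total := ((#|F| * s.+1)%:R).

(** Both sides are the logarithm of (s+1)! times the number of heavy sets. *)
Lemma ln_total : ln (s`!)%:R + ln total = s.+1%:R * ell * density f s.+1 L.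
Proof.
have l1' := l1; rewrite -densityE //; last by lra.
rewrite -lnM ?posrE ?ltr0n ?fact_gt0 ?muln_gt0 ?N0 // -natrM; congr (ln _%:R).
by rewrite factS; lia.
Qed.

(** This is [shadow_lower_bound] with W = (1 - rho) total. The estimates ln (1 - rho) >= - 2 rho and
    1 / (1 - rho) <= 1 + 2 rho cost 2 rho each, the first because ell >= 1, the second because the
    density is at most 1. *)
Lemma density_high (rho : R) : 0 <= rho <= 1 / 2 ->
  (1 - rho) * total <= \sum_(C in heavy f' s L') d C ->
  (0 < #|heavy f' s L'|)%N /\
  s%:R * density f s.+1 L - 4 * rho <= s%:R * density f' s L'.
Proof.
move=> /andP[r0 r1] hS.
have l1' := l1; have l0 : 0 < ell by lra.
have t0 : 0 < total :> R by rewrite ltr0n muln_gt0 N0.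
have W0 : 0 < (1 - rho) * total by rewrite mulr_gt0 //; lra.
have N'0 : (0 < #|heavy f' s L'|)%N.
  rewrite lt0n; apply/eqP => /eqP; rewrite cards_eq0 => /eqP e.
  by move: hS; rewrite e big_set0; lra.
split=> //.
have := @shadow_lower_bound R _ s.+1 F (fun B => @heavy_card f s.+1 L B) _ _ W0 hS.
rewrite densityE // => h.
have e2 := @densityE f' s L' s0 l0.
rewrite natrM lnM ?posrE ?ltr0n ?fact_gt0 // in e2.
rewrite lnM ?posrE // in h; last by lra.
have e1 := ln_total.
have Y0 := density_ge0 f s.+1 L; have Y1 := density_le1 f L (ltn0Sn s) l0.
set Y := density f s.+1 L in e1 h Y0 Y1 *; set Y' := density f' s L' in e2 *.
have hc : #|F|%:R / ((1 - rho) * total) * (s.+1%:R * ell * Y) = ell * Y / (1 - rho).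
  have hx : #|F|%:R != 0 :> R by rewrite pnatr_eq0 -lt0n.
  have hy : s.+1%:R != 0 :> R by rewrite pnatr_eq0.
  rewrite natrM; move: hx hy; move: (#|F|%:R) (s.+1%:R) => x y hx hy.
  have hr : 1 - rho != 0 by rewrite gt_eqF //; lra.
  by field; rewrite hx hy hr.
rewrite hc in h.
have hq : ell * Y / (1 - rho) <= ell * Y * (1 + 2 * rho).
  rewrite ler_pdivrMr; last by lra.
  have eY : 0 <= ell * Y by rewrite mulr_ge0 // ltW.
  have h1 : 1 <= (1 + 2 * rho) * (1 - rho) by nra.
  by have := ler_wpM2l eY h1; lra.
have hln : - (2 * rho) <= ln (1 - rho).
  have i0 : 0 < (1 - rho)^-1 by rewrite invr_gt0; lra.
  have := ln_le_subr1 i0; rewrite lnV ?posrE; last by lra.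
  have : (1 - rho)^-1 <= 1 + 2 * rho by rewrite -[leLHS]div1r ler_pdivrMr; [nra|lra].
  lra.
have hs : s.+1%:R = s%:R + 1 :> R by rewrite natr1.
rewrite hs in e1.
rewrite -(ler_pM2l l0) !mulrBr.
have hY : ell * Y * (2 * rho) <= ell * (2 * rho).
  by rewrite ler_wpM2r; [|nra|nra].
have hr : 2 * rho <= ell * (2 * rho) by nra.
lra.
Qed.

(** A shadow of degree at most t carries at most t flags, so at least alp total / t of them are
    retained. The factor s + 1 on the left is the gain: for t = n^x the product s y grows by y - x,
    up to ln alp / ell. *)
Lemma density_low (alp t : R) : 0 < alp -> 1 <= t ->
  alp * total <= \sum_(C in heavy f' s L' | d C <= t) d C ->
  (0 < #|heavy f' s L'|)%N /\
  s.+1%:R * density f s.+1 L + (ln alp - ln t) / ell <= s%:R * density f' s L'.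
Proof.
move=> a0 t1 hS.
have l1' := l1; have l0 : 0 < ell by lra.
have t0 : 0 < total :> R by rewrite ltr0n muln_gt0 N0.
have hN : alp * total <= #|heavy f' s L'|%:R * t.
  apply: le_trans hS _; rewrite mulr_natl -sumr_const [leRHS](bigID (fun C => d C <= t)) /=.
  rewrite -[leLHS]addr0; apply: lerD.
    by apply: ler_sum => C /andP[].
  by apply: sumr_ge0 => C _; lra.
have N'0 : (0 < #|heavy f' s L'|)%N.
  rewrite lt0n; apply/eqP => e; move: hN; rewrite e mul0r.
  by rewrite leNgt mulr_gt0.
split=> //.
have e2 := @densityE f' s L' s0 l0.
rewrite natrM lnM ?posrE ?ltr0n ?fact_gt0 // in e2.
have e1 := ln_total.
have : ln (alp * total) <= ln (#|heavy f' s L'|%:R * t).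
  have t00 : 0 < t by lra.
  by rewrite ler_ln ?posrE //; [exact: mulr_gt0|rewrite mulr_gt0 // ltr0n].
have t00 : 0 < t by lra.
rewrite (lnM a0 t0) lnM ?posrE ?ltr0n //.
move=> h; have e3 : ell * ((ln alp - ln t) / ell) = ln alp - ln t by field; rewrite gt_eqF.
by rewrite -(ler_pM2l l0) mulrDr e3; lra.
Qed.

End DensityStep.

End Process.
(** * Survival at a fixed threshold *)

Section FixedThreshold.
Variables (R : realType) (n : nat).
Local Notation state := ({set 'I_n} -> R).
Local Notation ell := (@ln R n%:R).
Implicit Types (f : state) (a C : {set 'I_n}).

(** The probability, given the state [f] with s rows to come, that the final permanent is below [Lt]
    in absolute value. *)
Fixpoint pfail (Lt : R) (s : nat) f : R :=
  if s is s'.+1 then avg (fun a => pfail Lt s' (expose a f))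
  else (`|f set0| < Lt)%R%:R.

Lemma pfail_le1 Lt s f : pfail Lt s f <= 1.
Proof.
elim: s f => [|s IH] f /=; first by case: (_ < _).
by rewrite -(@avg_cst R 'I_n 1); apply: ler_avg.
Qed.

Lemma heavy_gt0 f s L : 0 < density f s L -> (0 < #|heavy f s L|)%N.
Proof.
by rewrite lt0n; apply: contraTneq => e; rewrite /density e muln0 ln0 // mul0r ltxx.
Qed.

Lemma ln4_le : ln 4 <= ln (16 * 100) :> R.
Proof. by rewrite ler_ln ?posrE; lra. Qed.

Lemma ln16_le : ln 16 <= ln (16 * 100) :> R.
Proof. by rewrite ler_ln ?posrE; lra. Qed.

Section FixedLevel.
Variables (r : R).
Hypotheses (r01 : 0 <= r <= 1) (r200 : 97 / 108 <= r ^+ 200) (n2 : 1 <= ell)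
  (n1600 : ln (16 * 100) <= ell / 10 :> R).
(** In powers of n: t = n^(1/2) separates low from high degrees, tau = n^(-1/10) is a negligible
    share of the flags, and p = 2 n^(-1/4) is the Littlewood-Offord bound for degree t and g = 1. *)
Local Notation t := (expR (ell / 2)).
Local Notation tau := (expR (- (ell / 10))).
Local Notation p := (2 / expR (ell / 4)).

Lemma sqrt_threshold : Num.sqrt t = expR (ell / 4).
Proof.
have -> : t = expR (ell / 4) ^+ 2 by rewrite -expRM_natl; congr expR; field.
by rewrite sqrtr_sqr ger0_norm // expR_ge0.
Qed.

Section Step.
Variables (f : state) (s : nat) (L A b : R) (V : state -> R).
Hypotheses (L0 : 0 < L) (s0 : (0 < s)%N) (A0 : 0 <= A) (b0 : 0 <= b).
(** [V] stands for the failure probability with s rows to come, and [VY] is the induction hypothesis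
    on it. *)
Hypotheses (V1 : forall f', V f' <= 1)
  (VY : forall f', V f' <= A * (1 - density f' s L) + b).
Hypothesis Y9 : 9 / 10 <= density f s.+1 L.
Local Notation F := (heavy f s.+1 L).
Local Notation d C := ((deg F C)%:R).
Local Notation total := ((#|F| * s.+1)%:R).
Local Notation Y := (density f s.+1 L).

Lemma step_heavy_gt0 : (0 < #|F|)%N.
Proof. by apply: heavy_gt0; apply: lt_le_trans Y9; lra. Qed.

Lemma step_drift a (x : R) :
  s%:R * Y - x <= s%:R * density (expose a f) s L ->
  V (expose a f) <= A * (1 - Y) + b + A / s%:R * x.
Proof.
move=> h; apply: le_trans (VY _) _.
have s0R : 0 < s%:R :> R by rewrite ltr0n.
have h2 : Y - x / s%:R <= density (expose a f) s L.
  rewrite -(ler_pM2l s0R) mulrBr [s%:R * (x / _)]mulrCA divff ?mulr1 // gt_eqF //.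
have A0' := A0.
have -> : A * (1 - Y) + b + A / s%:R * x = A * (1 - (Y - x / s%:R)) + b by ring.
by rewrite lerD2r ler_wpM2l // lerD2l lerN2.
Qed.

(** All degrees are at most n, so [density_low] with t = n applies without any information on the
    degrees. *)
Lemma step_fallback a :
  total / 16 <= \sum_(C | xpredT C && (L <= `|expose a f C|)) d C :> R ->
  s%:R * Y - 2 <= s%:R * density (expose a f) s L.
Proof.
move=> h; have Y9' := Y9; have n2' := n2; have l0 : 0 < ell by lra.
have n1 : 1 <= n%:R :> R.
  rewrite ler1n lt0n; apply/eqP => e; move: l0; rewrite e ln0 ?ltxx //.
have h' : 1 / 16 * total <= \sum_(C in heavy (expose a f) s L | d C <= n%:R :> R) d C :> R.
  have -> : \sum_(C in heavy (expose a f) s L | d C <= n%:R :> R) d C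
     = \sum_(C in heavy (expose a f) s L | xpredT C) d C :> R.
    apply: eq_bigl => C; congr (_ && _); rewrite ler_nat -[X in (_ <= X)%N]card_ord.
    exact: max_card.
  rewrite heavy_mass; apply: le_trans h.
  by rewrite mulrC mul1r.
have c16 : 0 < 1 / 16 :> R by lra.
have [_] := density_low s0 n2 step_heavy_gt0 c16 n1 h'.
have -> : ln (1 / 16) = - ln 16 :> R by rewrite div1r lnV // posrE.
have l16 := ln16_le.
have n1600' := n1600.
rewrite mulrBl divff ?gt_eqF // mulNr.
have : ln 16 / ell <= 1 / 10 by rewrite ler_pdivrMr //; lra.
by rewrite -natr1; lra.
Qed.

(** With t = n^(1/2), [density_low] yields Y - 1/2 minus at most 1/5, and Y >= 9/10 leaves 1/5. *)
Lemma step_gain a (al : R) : 0 < al -> - (ln al) <= ell / 5 ->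
  al * total <= \sum_(C | (d C < t :> R) && (L <= `|expose a f C|)) d C :> R ->
  s%:R * Y - (- (1 / 5)) <= s%:R * density (expose a f) s L.
Proof.
move=> al0 hal h; have Y9' := Y9; have n2' := n2; have l0 : 0 < ell by lra.
have h' : al * total <= \sum_(C in heavy (expose a f) s L | d C <= t :> R) d C :> R.
  rewrite heavy_mass; apply: le_trans h _.
  rewrite [leLHS]big_mkcond [leRHS]big_mkcond; apply: ler_sum => C _.
  case: ltP => [/ltW -> //|_]; case: ifP => // _; exact: ler0n.
have t1 : 1 <= t by rewrite -[X in X <= _]expR0 ler_expR; lra.
have [_] := density_low s0 n2 step_heavy_gt0 al0 t1 h'.
rewrite expRK mulrBl.
have : ln al / ell >= - (1 / 5) by rewrite ler_pdivlMr //; lra.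
have -> : ell / 2 / ell = 1 / 2 by field; rewrite gt_eqF.
have -> : s.+1%:R = s%:R + 1 :> R by rewrite natr1.
by lra.
Qed.

(** Lost flags are of two kinds: those below low shadows, of share [th], and those below failing
    high shadows, of share [tau]. *)
Lemma step_high a (th : R) : 0 <= th -> th <= 1 / 4 -> tau <= 1 / 4 ->
  \sum_(C | d C < t :> R) d C <= th * total :> R ->
  \sum_(C | (t <= d C :> R) && (`|expose a f C| < 1 * L)) d C <= tau * total :> R ->
  s%:R * Y - 4 * (th + tau) <= s%:R * density (expose a f) s L.
Proof.
move=> th0 th4 tau4 hlow hhigh.
have tau0 : 0 < tau by exact: expR_gt0.
have rho01 : 0 <= th + tau <= 1 / 2 by apply/andP; split; lra.
suff hh : (1 - (th + tau)) * total <= \sum_(C in heavy (expose a f) s L) d C :> R.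
  by have [_] := density_high s0 n2 step_heavy_gt0 rho01 hh.
rewrite (eq_bigl (fun C => (C \in heavy (expose a f) s L) && xpredT C)); last first.
  by move=> C; rewrite andbT.
rewrite heavy_mass /=.
suff : total - \sum_(C | L <= `|expose a f C|) d C <= (th + tau) * total :> R by lra.
rewrite -{1}(sum_deg_heavy f s L) [X in X - _](bigID (fun C => L <= `|expose a f C|)) /= addrAC subrr add0r.
rewrite mulrDl (bigID (fun C => d C < t :> R)) /=; apply: lerD.
  apply: le_trans hlow; rewrite [leLHS]big_mkcond [leRHS]big_mkcond; apply: ler_sum => C _.
  case: (d C < t :> R); rewrite ?andbF //=; case: ifP => // _; exact: ler0n.
apply: le_trans hhigh; rewrite le_eqVlt; apply/orP; left; apply/eqP; apply: eq_bigl => C.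
by rewrite -ltNge -leNgt mul1r andbC.
Qed.

(** Meant for few remaining rows, where r^(s+1) is not small: the failure of high shadows, of
    probability at most p / tau, is charged in full. *)
Lemma step_small : tau <= 1 / 4 ->
  \sum_(C | d C < t :> R) d C <= tau * total :> R ->
  avg (fun a => V (expose a f)) <= A * (1 - Y) + b + A / s%:R * (8 * tau) + p / tau.
Proof.
move=> tau4 hlow; have tau0 : 0 < tau by exact: expR_gt0.
have := high_loss L0 step_heavy_gt0 (@ler01 R) (expR_gt0 (ell / 2)) tau0.
rewrite sqrt_threshold -[1 + 1]/2; set G := avg _ => hG.
apply: le_trans (_ : avg (fun a => (A * (1 - Y) + b + A / s%:R * (8 * tau)) +
   (tau * total < \sum_(C | (t <= d C :> R) && (`|expose a f C| < 1 * L)) d C)%R%:R) <= _); last first.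
  by rewrite avgD avg_cst lerD2l.
have Y1 : Y <= 1 by apply: density_le1 => //; apply: lt_le_trans n2.
have base0 : 0 <= A * (1 - Y) + b + A / s%:R * (8 * tau).
  have h1 : 0 <= A * (1 - Y) by rewrite mulr_ge0 ?subr_ge0.
  have h2 : 0 <= A / s%:R * (8 * tau) by rewrite mulr_ge0 ?divr_ge0 ?mulr_ge0 ?expR_ge0.
  by have b0' := b0; lra.
apply: ler_avg => a; case: ltP => [_|hh] /=.
  by apply: le_trans (V1 _) _; rewrite -[leLHS]add0r lerD2r.
rewrite addr0; apply: step_drift.
have := step_high (ltW tau0) tau4 tau4 hlow hh.
by rewrite (_ : 4 * (tau + tau) = 8 * tau) //; ring.
Qed.

Lemma rate_sqr : 97 / 108 <= r ^+ 2.
Proof. by apply: le_trans r200 _; case/andP: r01 => ? ?; apply: ler_wiXn2l. Qed.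

(* By the share of flags below shadows of degree < t: if it is at least 1/100 the
   density grows; if it is below tau almost all flags survive; in between, the gain
   1/5 of probability >= 1/3 outweighs the loss 2/25. When too many high shadows
   fail, [step_fallback] limits the loss. *)
Lemma step_large : tau <= 1 / 4 ->
  avg (fun a => V (expose a f)) <=
    A * (1 - Y) + b + A / s%:R * (8 * tau + 2 * (p / tau)) + 4 * r ^+ s.+1.
Proof.
move=> tau4; have tau0 : 0 < tau by exact: expR_gt0.
have s0R : 0 < s%:R :> R by rewrite ltr0n.
have N0 := step_heavy_gt0.
have As0 : 0 <= A / s%:R by rewrite divr_ge0 // ltW.
have Y1 : Y <= 1 by apply: density_le1 => //; apply: lt_le_trans n2.
have rs0 : 0 <= r ^+ s.+1 by case/andP: r01 => ? _; exact: exprn_ge0.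
have p0 : 0 <= p / tau by rewrite !divr_ge0 ?expR_ge0.
have base0 : 0 <= A * (1 - Y) + b by rewrite addr_ge0 ?mulr_ge0 ?subr_ge0.
have t0 : 0 < total :> R by exact: total_gt0.
have n2' := n2; have n1600' := n1600.
set m : R := \sum_(C | d C < t :> R) d C.
have [hm|hm] := leP (total / 100) m.
  (* A share of 1/100 gives kap = 200, and at least 1/16 of it is kept; hence the constants 200 and
     16 * 100. *)
  have hm' : 2 * total <= 200%:R * m :> R by lra.
  have := @exp_loss R n f s L N0 200 r (fun C => d C < t :> R) isT r01 r200 hm'.
  rewrite -/m; set E := avg _ => hE.
  apply: (@le_trans _ _ (A * (1 - Y) + b + E)); last first.
    have : 0 <= A / s%:R * (8 * tau + 2 * (p / tau)) by rewrite mulr_ge0 // addr_ge0 // mulr_ge0 // ltW.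
    by lra.
  rewrite -[X in X + E](@avg_cst R 'I_n) -avgD; apply: ler_avg => a.
  case: ltP => [_|hh] /=; first by apply: le_trans (V1 _) _; rewrite -[leLHS]add0r lerD2r.
  rewrite addr0; have hh' : 1 / (16 * 100) * total <= \sum_(C | (d C < t :> R) && (L <= `|expose a f C|)) d C :> R.
    by apply: le_trans hh; lra.
  have c1 : 0 < 16 * 100 :> R by lra.
  have c0 : 0 < 1 / (16 * 100) :> R by rewrite div1r invr_gt0.
  have hc : - ln (1 / (16 * 100)) <= ell / 5 by rewrite div1r (lnV c1) opprK; lra.
  have := step_drift (step_gain c0 hc hh').
  have : 0 <= A / s%:R * (1 / 5) by rewrite mulr_ge0.
  by lra.
have hfb : 2 * total <= 2%:R * \sum_(C | xpredT C) d C :> R by rewrite (sum_deg_heavy f s L).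
have := @exp_loss R n f s L N0 2 r xpredT isT r01 rate_sqr hfb.
rewrite (sum_deg_heavy f s L); set EF := avg _ => hEF.
have := high_loss L0 N0 (@ler01 R) (expR_gt0 (ell / 2)) tau0.
rewrite sqrt_threshold -[1 + 1]/2; set EG := avg _ => hEG.
have [hm2|hm2] := leP m (tau * total).
  apply: (@le_trans _ _ ((A * (1 - Y) + b + A / s%:R * (8 * tau)) + EF + 2 * (A / s%:R) * EG)); last first.
    have : A / s%:R * EG <= A / s%:R * (p / tau) by rewrite ler_wpM2l.
    by lra.
  rewrite -avgZ -[X in X + EF + _](@avg_cst R 'I_n) -!avgD; apply: ler_avg => a.
  case: ltP => [_|hF] /=.
    apply: le_trans (V1 _) _; rewrite addrAC -[leLHS]add0r lerD2r.
    have h1 : 0 <= A / s%:R * (8 * tau) by rewrite !mulr_ge0 ?expR_ge0.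
    by apply: addr_ge0; [exact: addr_ge0|rewrite !mulr_ge0].
  rewrite addr0; case: ltP => [_|hG] /=.
    apply: le_trans (step_drift (step_fallback hF)) _.
    have : 0 <= A / s%:R * (8 * tau) by rewrite !mulr_ge0 // ltW.
    by lra.
  rewrite mulr0 addr0; apply: step_drift.
  have := step_high (ltW tau0) tau4 tau4 hm2 hG.
  by rewrite (_ : 4 * (tau + tau) = 8 * tau) //; ring.
have m0 : 0 < m by apply: lt_trans hm2; rewrite mulr_gt0.
have := @half_loss R n f s L (fun C => d C < t :> R) m0.
rewrite -/m; set EH := avg _ => hEH.
(* In units of A / s: a gain of 1/5 by default; 7/25 = 1/5 + 2/25 turns it into the loss 2/25 when
   more than 3/4 of the low mass fails; 2 pays for the fallback. On average -1/5 + (7/25)(2/3) =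
   -1/75 is negative. *)
apply: (@le_trans _ _ ((A * (1 - Y) + b - A / s%:R * (1 / 5)) + EF + 2 * (A / s%:R) * EG
     + (7 / 25 * (A / s%:R)) * EH)); last first.
  have : A / s%:R * EG <= A / s%:R * (p / tau) by rewrite ler_wpM2l.
  have : A / s%:R * EH <= A / s%:R * (2 / 3) by rewrite ler_wpM2l.
  have : 0 <= A / s%:R * (8 * tau) by rewrite !mulr_ge0 // ltW.
  by move: (A / s%:R) As0 => As As0; lra.
rewrite -!avgZ -[X in X + EF + _ + _](@avg_cst R 'I_n) -!avgD; apply: ler_avg => a.
have split : m = \sum_(C | (d C < t :> R) && (L <= `|expose a f C|)) d C +
                 \sum_(C | (d C < t :> R) && (`|expose a f C| < L)) d C.
  rewrite /m (bigID (fun C => L <= `|expose a f C|)) /=; congr (_ + _).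
  by apply: eq_bigl => C; rewrite -ltNge.
case: (ltP (3 / 4 * m)) => [_|hH] /=; last first.
  have al0 : 0 < tau / 4 by rewrite divr_gt0.
  have hal : - ln (tau / 4) <= ell / 5.
    rewrite ln_div ?posrE // expRK.
    by have := ln4_le; lra.
  have hh : tau / 4 * total <= \sum_(C | (d C < t :> R) && (L <= `|expose a f C|)) d C :> R by lra.
  have := step_drift (step_gain al0 hal hh).
  have : 0 <= 2 * (A / s%:R) * (tau * total < \sum_(C | (t <= d C :> R) && (`|expose a f C| < 1 * L)) d C)%R%:R.
    by rewrite !mulr_ge0.
  have : 0 <= ((\sum_(C | xpredT C && (L <= `|expose a f C|)) d C : R) < total / 16)%R%:R :> R by [].
  by rewrite mulr0 /=; lra.
case: ltP => [_|hF] /=.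
  have : 0 <= 2 * (A / s%:R) * (tau * total < \sum_(C | (t <= d C :> R) && (`|expose a f C| < 1 * L)) d C)%R%:R.
    by rewrite !mulr_ge0.
  have := V1 (expose a f).
  by lra.
case: ltP => [_|hG] /=.
  by have := step_drift (step_fallback hF); lra.
have th0 : 0 <= 1 / 100 :> R by rewrite divr_ge0.
have th4 : 1 / 100 <= 1 / 4 :> R by lra.
have hm' : m <= 1 / 100 * total by lra.
have := step_drift (step_high th0 th4 tau4 hm' hG).
have tau100 : tau <= 1 / 100.
  by rewrite -(ler_pM2r t0); lra.
have : A / s%:R * (4 * (1 / 100 + tau)) <= A / s%:R * (2 / 25) by rewrite ler_wpM2l //; lra.
by lra.
Qed.

End Step.

(** At most C(n, s) shadows are low, so at most n^(s+1/2) / s! flags lie below them, whereas s!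
    total = n^((s+1) y) >= n^(s+3/4). *)
Lemma low_mass_small f s (L : R) (s0 : nat) : (0 < s)%N -> (s.+1 <= s0)%N ->
  (0 < #|heavy f s.+1 L|)%N -> 1 - (4 * s0%:R)^-1 <= density f s.+1 L ->
  \sum_(C | (deg (heavy f s.+1 L) C)%:R < t :> R) (deg (heavy f s.+1 L) C)%:R
    <= tau * (#|heavy f s.+1 L| * s.+1)%:R :> R.
Proof.
move=> sgt hs N0 hY; have n2' := n2.
have n0 : (0 < n)%N.
  by rewrite lt0n; apply/eqP => e; move: n2'; rewrite e ln0 // ler10.
have n0R : 0 < n%:R :> R by rewrite ltr0n.
have f0 : 0 < s`!%:R :> R by rewrite ltr0n fact_gt0.
have t0 : 0 < (#|heavy f s.+1 L| * s.+1)%:R :> R by exact: total_gt0.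
have h1 : \sum_(C | (deg (heavy f s.+1 L) C)%:R < t :> R) (deg (heavy f s.+1 L) C)%:R
    <= t * 'C(n, s)%:R :> R.
  rewrite -[n in 'C(n, _)]card_ord -card_draws mulr_natr -sumr_const big_set.
  rewrite [leLHS]big_mkcond [leRHS]big_mkcond; apply: ler_sum => C _ /=.
  have [d0|d0] := posnP (deg (heavy f s.+1 L) C).
    by rewrite d0; do 2 case: ifP => _ //; rewrite expR_ge0.
  rewrite unfold_in (deg_card d0) eqxx; case: ltP => [/ltW //|_]; exact: expR_ge0.
apply: le_trans h1 _; rewrite -(ler_pM2l f0).
have h2 : s`!%:R * (t * 'C(n, s)%:R) <= expR (ell / 2 + s%:R * ell) :> R.
  rewrite mulrCA -natrM mulnC bin_ffact expRD ler_pM2l ?expR_gt0 //.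
  rewrite expRM_natl lnK ?posrE // -natrX ler_nat.
  exact: leq_ffact_exp.
apply: le_trans h2 _.
have e := ln_total sgt n2 N0.
have -> : s`!%:R * (tau * (#|heavy f s.+1 L| * s.+1)%:R)
   = expR (- (ell / 10) + s.+1%:R * ell * density f s.+1 L).
  by rewrite expRD -e expRD !lnK ?posrE //; ring.
rewrite ler_expR.
have hY2 : s.+1%:R - 1 / 4 <= s.+1%:R * density f s.+1 L.
  have : s.+1%:R * (1 - (4 * s0%:R)^-1) <= s.+1%:R * density f s.+1 L by rewrite ler_pM2l // ltr0n.
  apply: le_trans; rewrite mulrBr mulr1 lerD2l lerN2.
  have s0R : 0 < s0%:R :> R by rewrite ltr0n (leq_trans _ hs).
  rewrite ler_pdivrMr ?mulr_gt0 //.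
  have : s.+1%:R <= s0%:R :> R by rewrite ler_nat.
  by lra.
have : ell * (s.+1%:R - 1 / 4) <= ell * (s.+1%:R * density f s.+1 L).
  by rewrite ler_wpM2l //; lra.
by rewrite -natr1; lra.
Qed.

(** With one row left the only shadow is the empty set, and its degree, the number of heavy
    singletons, is at least n^(9/10). *)
Lemma pfail_one_row f (L Lt : R) : 0 < L -> Lt <= L -> 9 / 10 <= density f 1 L ->
  pfail Lt 1 f <= p.
Proof.
move=> L0 hL hY; have n2' := n2; have l0 : 0 < ell by lra.
have dE : (deg (heavy f 1 L) set0)%:R = #|heavy f 1 L|%:R :> R.
  have := sum_deg_heavy f 0 L; rewrite muln1 => <-; rewrite (bigD1 set0) //= big1 ?addr0 // => C C0.
  have [-> //|d0] := posnP (deg (heavy f 1 L) C).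
  by move/eqP: (deg_card d0); rewrite cards_eq0 (negbTE C0).
have N0 : (0 < #|heavy f 1 L|)%N by apply: heavy_gt0; lra.
have tN : t <= (deg (heavy f 1 L) set0)%:R.
  rewrite dE -[leRHS]lnK ?posrE ?ltr0n // ler_expR.
  have := densityE f L (ltn0Sn 0) l0; rewrite mul1n mul1r => ->.
  have : ell * (9 / 10) <= ell * density f 1 L by rewrite ler_pM2l.
  by lra.
have := expose_small_ball L0 (@ler01 R) (expR_gt0 _) tN.
rewrite sqrt_threshold -[1 + 1]/2; apply: le_trans.
apply: ler_avg => a; case: ltP => //= h; rewrite mul1r.
by rewrite (lt_le_trans h hL).
Qed.

(** * Induction over the rows at a fixed threshold *)

Section Induction.
Variables (s0 : nat) (L Lt : R).
Hypotheses (s03 : (3 <= s0)%N) (L0 : 0 < L) (hL : Lt <= L) (tau4 : tau <= 1 / 4).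
Local Notation A := (@GRing.mul R 4 s0%:R).

Lemma A_ge12 : 12 <= A :> R.
Proof.
have : 3%:R <= s0%:R :> R by rewrite ler_nat.
by lra.
Qed.

(** Below density 1 - 1/A the claimed bound is at least 1 and holds trivially; A >= 12 puts the
    other case above 9/10. *)
Lemma small_or_dense f s (b : R) : 0 <= b ->
  (1 - A^-1 <= density f s L -> 9 / 10 <= density f s L ->
     pfail Lt s f <= A * (1 - density f s L) + b) ->
  pfail Lt s f <= A * (1 - density f s L) + b.
Proof.
move=> b0 h; have A12 := A_ge12.
have Ai : A^-1 <= 1 / 12 by rewrite -[leLHS]div1r ler_pdivrMr; lra.
have [hY|hY] := leP (1 - A^-1) (density f s L); first by apply: h => //; lra.
apply: le_trans (pfail_le1 _ _ _) _.
have : A * A^-1 <= A * (1 - density f s L) by rewrite ler_pM2l; lra.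
by rewrite divff; [lra|rewrite gt_eqF //; lra].
Qed.

(** While at most s0 rows remain, density 1 - 1/A with A = 4 s0 forces the low mass below [tau] by
    [low_mass_small], so [step_small] applies at every row. *)
Lemma pfail_few_rows s f : (s.+1 <= s0)%N ->
  pfail Lt s.+1 f <= A * (1 - density f s.+1 L) + (p + s%:R * (A * (8 * tau) + p / tau)).
Proof.
have A12 := A_ge12.
have p0 : 0 <= p by rewrite divr_ge0 ?expR_ge0.
have e0 : 0 <= A * (8 * tau) + p / tau.
  by rewrite addr_ge0 ?mulr_ge0 ?divr_ge0 ?expR_ge0.
elim: s f => [|s IH] f hs.
  rewrite mul0r addr0; apply: small_or_dense => // _ Y9.
  have Y1 : density f 1 L <= 1 by apply: density_le1 => //; apply: lt_le_trans n2.
  have : 0 <= A * (1 - density f 1 L) by rewrite mulr_ge0; lra.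
  by have := pfail_one_row L0 hL Y9; lra.
set b := p + s%:R * _ in IH.
have b0 : 0 <= b by rewrite addr_ge0 // mulr_ge0.
have -> : p + s.+1%:R * (A * (8 * tau) + p / tau) = b + (A * (8 * tau) + p / tau).
  by rewrite /b -natr1; ring.
apply: small_or_dense => [|hY Y9]; first by rewrite addr_ge0.
have N0 : (0 < #|heavy f s.+2 L|)%N by apply: heavy_gt0; lra.
have A0 : 0 <= A by lra.
have := @step_small f s.+1 L A b (pfail Lt s.+1) L0 (ltn0Sn s) A0 b0 (pfail_le1 Lt s.+1)
   (fun f' => IH f' (ltnW hs)) Y9 tau4 (low_mass_small (ltn0Sn s) hs N0 hY).
move=> h; apply: le_trans h _.
have : A / s.+1%:R * (8 * tau) <= A * (8 * tau).
  rewrite ler_wpM2r ?mulr_ge0 ?expR_ge0 //.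
  by rewrite ler_pdivrMr ?ltr0n // ler_peMr // ler1n.
move=> hh; rewrite [leRHS]addrA -[leLHS]addrA lerD2l lerD2r.
exact: hh.
Qed.

(** Errors of [step_small] over the last s0 rows and of [step_large] over k earlier ones. The latter
    carry the factor 1/s, whose sum over all rows is only of order ln n. *)
Definition fixed_error (k : nat) : R :=
  p + s0%:R * (A * (8 * tau) + p / tau) +
  \sum_(i < k) (A / (s0 + i)%:R * (8 * tau + 2 * (p / tau)) + 4 * r ^+ (s0 + i).+1).

Lemma pfail_many_rows k f :
  pfail Lt (s0 + k) f <= A * (1 - density f (s0 + k) L) + fixed_error k.
Proof.
have A12 := A_ge12; have A0 : 0 <= A by lra.
have p0 : 0 <= p by rewrite divr_ge0 ?expR_ge0.
have e0 : 0 <= A * (8 * tau) + p / tau.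
  by rewrite addr_ge0 ?mulr_ge0 ?divr_ge0 ?expR_ge0.
have r0 : 0 <= r by case/andP: r01.
have i0 (i : nat) : 0 <= A / (s0 + i)%:R * (8 * tau + 2 * (p / tau)) + 4 * r ^+ (s0 + i).+1.
  by rewrite addr_ge0 ?mulr_ge0 ?divr_ge0 ?addr_ge0 ?mulr_ge0 ?divr_ge0 ?expR_ge0 ?exprn_ge0.
have b0 j : 0 <= fixed_error j.
  by rewrite /fixed_error addr_ge0 ?sumr_ge0 ?addr_ge0 // mulr_ge0.
elim: k f => [|k IH] f.
  rewrite addn0 /fixed_error big_ord0 addr0.
  have s0gt : (0 < s0)%N by rewrite (leq_trans _ s03).
  have := @pfail_few_rows s0.-1 f; rewrite (prednK s0gt) => /(_ (leqnn _)) h.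
  by apply: le_trans h _; rewrite lerD2l lerD2l ler_wpM2r // ler_nat leq_pred.
have -> : fixed_error k.+1 = fixed_error k +
    (A / (s0 + k)%:R * (8 * tau + 2 * (p / tau)) + 4 * r ^+ (s0 + k).+1).
  by rewrite /fixed_error big_ord_recr /= addrA.
rewrite addnS.
apply: small_or_dense => [|_ Y9]; first by rewrite addr_ge0.
have sk0 : (0 < s0 + k)%N by rewrite addn_gt0 (leq_trans _ s03).
have := @step_large f (s0 + k) L A (fixed_error k) (pfail Lt (s0 + k)) L0 sk0 A0 (b0 k)
  (pfail_le1 Lt (s0 + k)) IH Y9 tau4.
by move=> h; apply: le_trans h _; rewrite !addrA.
Qed.

End Induction.
End FixedLevel.
End FixedThreshold.
(** * Growth of the threshold *)

Section Growth.
Variables (R : realType) (n : nat).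
Local Notation state := ({set 'I_n} -> R).
Local Notation ell := (@ln R n%:R).
Implicit Types (f : state) (a C : {set 'I_n}).

(** This is k! >= (k / e)^k; the induction step is (1 + 1/k)^k <= e. *)
Lemma ln_fact_ge (k : nat) : (0 < k)%N -> k%:R * (ln k%:R - 1) <= ln k`!%:R :> R.
Proof.
elim: k => // -[|k] IH _; first by rewrite ln1 sub0r mulrN1 lerN10.
have k0 : 0 < k.+1%:R :> R by rewrite ltr0n.
have h := IH isT; rewrite factS natrM lnM ?posrE ?ltr0n ?fact_gt0 //.
have hk : k.+1%:R * (ln k.+2%:R - ln k.+1%:R) <= 1 :> R.
  rewrite -ln_div ?posrE ?ltr0n //.
  have q0 : 0 < k.+2%:R / k.+1%:R :> R by rewrite divr_gt0 ?ltr0n.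
  have := ln_le_subr1 q0.
  have -> : k.+2%:R / k.+1%:R - 1 = k.+1%:R^-1 :> R.
    by rewrite -[k.+2%:R]natr1 mulrDl divff ?gt_eqF // addrAC subrr add0r mul1r.
  by rewrite -(ler_pM2l k0) divff // gt_eqF.
have -> : k.+2%:R = k.+1%:R + 1 :> R by rewrite natr1.
move: h hk; rewrite -[in ln k.+2%:R]natr1; move: (k.+1%:R) => x h hk.
by lra.
Qed.

(** A single heavy set suffices: s! >= (s / e)^s >= (eps n / e)^s. *)
Lemma density_lower_bound f s (L eps : R) : (0 < s)%N -> 0 < ell -> 0 < eps ->
  eps * n%:R <= s%:R -> (0 < #|heavy f s L|)%N ->
  1 - (1 - ln eps) / ell <= density f s L.
Proof.
move=> s0 l0 e0 hs N0.
have s0R : 0 < s%:R :> R by rewrite ltr0n.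
have n0 : 0 < n%:R :> R.
  by rewrite ltr0n lt0n; apply/eqP => e; move: l0; rewrite e ln0 // ltxx.
rewrite ler_pdivlMr ?mulr_gt0 //.
have h1 : ln s`!%:R <= ln (s`! * #|heavy f s L|)%:R :> R.
  rewrite ler_ln ?posrE ?ltr0n ?muln_gt0 ?fact_gt0 ?N0 // ler_nat leq_pmulr //.
have h2 := ln_fact_ge s0.
have h3 : ln eps + ell <= ln s%:R.
  by rewrite -lnM ?posrE // ler_ln ?posrE ?mulr_gt0.
have h4 : s%:R * (ln eps + ell - 1) <= s%:R * (ln s%:R - 1).
  by rewrite ler_pM2l //; lra.
have -> : (1 - (1 - ln eps) / ell) * (s%:R * ell) = s%:R * (ln eps + ell - 1).
  by field; rewrite gt_eqF.
by lra.
Qed.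

Section GrowthStep.
Variables (f : state) (s : nat) (L c eps r lip : R) (kap : nat).
Variables (V : state -> R) (H : R -> R).
Local Notation F := (heavy f s.+1 L).
Local Notation d C := ((deg F C)%:R).
Local Notation total := ((#|F| * s.+1)%:R).
Local Notation Y := (density f s.+1 L).
Local Notation t := (expR ((1 - c) * ell)).
Local Notation g := (expR ((1 / 2 - c) * ell)).
Local Notation psi := (ln L / ell + n%:R / c * Y).

(* Either most flags have degree above n^(1-c), and the threshold is multiplied by
   n^(1/2-c), or the density increases by at least c/(2s); in both cases the
   potential psi gains 1/2 - 2c. *)
Lemma growth_step :
  0 < L -> (0 < s)%N -> (s <= n)%N -> (0 < #|F|)%N ->
  0 < c -> c <= 1 / 4 -> 0 < eps -> eps <= 1 -> eps * n%:R <= s%:R ->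
  0 <= r <= 1 -> 97 / 108 <= r ^+ kap -> (8 <= kap)%N ->
  16 / (c ^+ 2 * eps) <= kap%:R ->
  1 <= ell -> ln (16 * 100) <= ell / 10 -> 1 - ln eps + ln (8 * kap%:R) <= c / 2 * ell ->
  0 <= lip -> (forall x, 0 <= H x) -> (forall x y, x <= y -> H y <= H x) ->
  (forall x y, x <= y -> H x <= H y + lip * (y - x)) ->
  (forall f', V f' <= 1) ->
  (forall f' (L' : R), 0 < L' -> (0 < #|heavy f' s L'|)%N ->
     V f' <= H (ln L' / ell + n%:R / c * density f' s L')) ->
  avg (fun a => V (expose a f)) <= H (psi + (1 / 2 - 2 * c))
    + lip * (2 / (c * eps) + 1 / 2) * (expR (- (c / 2 * ell)) * kap%:R) + 2 * r ^+ s.+1.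
Proof.
move=> L0 s0 sn N0 c0 c4.
have c1 : 0 <= 1 - c by lra.
have c2 : 0 <= 1 / 2 - c by lra.
have c3 (x : R) : 0 <= x -> - x <= 1 / 2 - 2 * c by lra.
have hl16 (x : R) : ln (16 * 100) <= x / 10 -> ln 16 <= 1 / 10 * x.
  by have := ln16_le R; lra.
move=> e0 e1 es r01 rk k8 kbig l1 l1600 lbig lip0 H0 Hmono Hlip V1 VH.
have l0 : 0 < ell by apply: lt_le_trans l1.
have s0R : 0 < s%:R :> R by rewrite ltr0n.
have n0R : 0 < n%:R :> R by rewrite ltr0n (leq_trans s0 sn).
have k0R : 0 < kap%:R :> R by rewrite ltr0n (leq_trans _ k8).
have k8R : 8%:R <= kap%:R :> R by rewrite ler_nat.
have t0 : 0 < total :> R by exact: total_gt0.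
have snR : s%:R <= n%:R :> R by rewrite ler_nat.
have ncs0 : 0 <= n%:R / c / s%:R by rewrite !divr_ge0 // ltW.
have ncs1 : 1 <= n%:R / s%:R :> R by rewrite ler_pdivlMr ?mul1r.
have ncs2 : n%:R / s%:R <= eps^-1 by rewrite ler_pdivrMr // ler_pdivlMl.
have YC : 1 - (1 - ln eps) / ell <= Y.
  apply: density_lower_bound => //; apply: le_trans es _; by rewrite ler_nat.
have Y1 : Y <= 1 by exact: density_le1.
have drift (x Y' : R) : s%:R * Y - x <= s%:R * Y' ->
    n%:R / c * Y - n%:R / c / s%:R * x <= n%:R / c * Y'.
  move=> h; have -> : n%:R / c * Y - n%:R / c / s%:R * x = n%:R / c / s%:R * (s%:R * Y - x).
    by field; rewrite !gt_eqF.
  have -> : n%:R / c * Y' = n%:R / c / s%:R * (s%:R * Y') by field; rewrite !gt_eqF.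
  by rewrite ler_wpM2l.
have rs0 : 0 <= r ^+ s.+1 by case/andP: r01 => ? _; exact: exprn_ge0.
have p0 : 0 <= expR (- (c / 2 * ell)) * kap%:R by rewrite mulr_ge0 ?expR_ge0.
have K0 : 0 <= 2 / (c * eps) by rewrite divr_ge0 // mulr_ge0 // ltW.
have lipK : 0 <= lip * (2 / (c * eps) + 1 / 2) by rewrite mulr_ge0 // addr_ge0.
set m : R := \sum_(C | d C < t :> R) d C.
(* First case, many low flags: of a share 2 / kap at least 1/16 survives, which leaves 1 / (8
   kap). *)
have [hm|hm] := leP (2 / kap%:R * total) m.
  have hm' : 2 * total <= kap%:R * m.
    by move: hm; rewrite mulrAC ler_pdivrMr // mulrC [m * _]mulrC.
  have := @exp_loss R n f s L N0 kap r (fun C => d C < t :> R) (leq_trans _ k8) r01 rk hm'.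
  move=> /(_ isT); rewrite -/m; set E := avg _ => hE.
  apply: (@le_trans _ _ (H (psi + (1 / 2 - 2 * c)) + E)); last first.
    have : 0 <= lip * (2 / (c * eps) + 1 / 2) * (expR (- (c / 2 * ell)) * kap%:R) by rewrite mulr_ge0.
    by lra.
  rewrite -[X in X + E](@avg_cst R 'I_n) -avgD; apply: ler_avg => a.
  case: ltP => [_|hh] /=; first by apply: le_trans (V1 _) _; rewrite -[leLHS]add0r lerD2r.
  rewrite addr0.
  have al0 : 0 < (8 * kap%:R)^-1 :> R by rewrite invr_gt0 mulr_gt0.
  have t1 : 1 <= t by rewrite -[X in X <= _]expR0 ler_expR mulr_ge0 // ltW.
  have hh' : (8 * kap%:R)^-1 * total
      <= \sum_(C in heavy (expose a f) s L | d C <= t :> R) d C :> R.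
    rewrite heavy_mass; apply: (@le_trans _ _ (m / 16)).
      have -> : (8 * kap%:R)^-1 * total = 2 / kap%:R * total / 16 :> R by field; rewrite gt_eqF.
      by lra.
    apply: le_trans hh _; rewrite [leLHS]big_mkcond [leRHS]big_mkcond; apply: ler_sum => C _.
    case: ltP => [/ltW -> //|_]; case: ifP => // _; exact: ler0n.
  have [N'0] := density_low s0 l1 N0 al0 t1 hh'.
  rewrite expRK lnV ?posrE ?mulr_gt0 // => hd.
  (* By [YC] the density is within (1 - ln eps) / ell of 1, so the gain Y - (1 - c) is c up to terms
     that [lbig] bounds by c / 2. *)
  have hd2 : s%:R * Y - (- (c / 2)) <= s%:R * density (expose a f) s L.
    apply: le_trans hd.
    have -> : s.+1%:R = s%:R + 1 :> R by rewrite natr1.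
    have -> : (- ln (8 * kap%:R) - (1 - c) * ell) / ell = - (ln (8 * kap%:R) / ell) - (1 - c).
      by field; rewrite gt_eqF.
    have : (1 - ln eps + ln (8 * kap%:R)) / ell <= c / 2 by rewrite ler_pdivrMr.
    rewrite [(1 - ln eps + _) / ell]mulrDl.
    by lra.
  have := VH (expose a f) L L0 N'0 => hV; apply: le_trans hV _; apply: Hmono.
  rewrite -[psi + _]addrA lerD2l.
  have := drift _ _ hd2.
  (* The potential gains n / (2 s), which is at least 1/2. *)
  have -> : n%:R / c / s%:R * - (c / 2) = - (n%:R / s%:R / 2) by field; rewrite !gt_eqF.
  by lra.
have hfb : 2 * total <= 2%:R * \sum_(C | xpredT C) d C :> R by rewrite (sum_deg_heavy f s L).
have r2 : 97 / 108 <= r ^+ 2.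
  by apply: le_trans rk _; case/andP: r01 => ? ?; apply: ler_wiXn2l => //; exact: leq_trans k8.
have := @exp_loss R n f s L N0 2 r xpredT isT r01 r2 hfb.
rewrite (sum_deg_heavy f s L); set EF := avg _ => hEF.
have th0 : 0 < 2 / kap%:R :> R by rewrite divr_gt0.
have g1 : 1 <= g by rewrite -[X in X <= _]expR0 ler_expR mulr_ge0 // ltW.
have g0 : 0 <= g by exact: expR_ge0.
have := high_loss L0 N0 g0 (expR_gt0 ((1 - c) * ell)) th0.
set EG := avg _ => hEG.
have hEG2 : EG <= expR (- (c / 2 * ell)) * kap%:R.
  apply: le_trans hEG _.
  have -> : Num.sqrt t = expR ((1 - c) / 2 * ell).
    have -> : t = expR ((1 - c) / 2 * ell) ^+ 2 by rewrite -expRM_natl; congr expR; field.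
    by rewrite sqrtr_sqr ger0_norm // expR_ge0.
  have -> : expR (- (c / 2 * ell)) * kap%:R = 2 * (g / expR ((1 - c) / 2 * ell)) / (2 / kap%:R).
    rewrite -expRN -expRD.
    have -> : (1 / 2 - c) * ell + - ((1 - c) / 2 * ell) = - (c / 2 * ell) by field.
    by field; rewrite gt_eqF.
  rewrite ler_pM2r ?invr_gt0 // mulrA ler_pM2r ?invr_gt0 ?expR_gt0 //.
  by lra.
(* When too many high shadows fail, the fallback lowers psi by at most 2 / (c eps); the Lipschitz
   bound on [H] charges for the distance from there to the target psi + 1/2 - 2c. *)
apply: (@le_trans _ _ (H (psi + (1 / 2 - 2 * c)) + EF + (lip * (2 / (c * eps) + 1 / 2)) * EG)); last first.
  have : lip * (2 / (c * eps) + 1 / 2) * EG <=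
    lip * (2 / (c * eps) + 1 / 2) * (expR (- (c / 2 * ell)) * kap%:R) by rewrite ler_wpM2l.
  by lra.
rewrite -avgZ -[X in X + EF + _](@avg_cst R 'I_n) -!avgD; apply: ler_avg => a.
case: ltP => [_|hF] /=.
  apply: le_trans (V1 _) _; rewrite addrAC -[leLHS]add0r lerD2r.
  by rewrite addr_ge0 // mulr_ge0.
rewrite addr0; case: ltP => [_|hG] /=.
  have n1 : 1 <= n%:R :> R by rewrite ler1n (leq_trans s0 sn).
  have h' : 1 / 16 * total <= \sum_(C in heavy (expose a f) s L | d C <= n%:R :> R) d C :> R.
    have -> : \sum_(C in heavy (expose a f) s L | d C <= n%:R :> R) d C
       = \sum_(C in heavy (expose a f) s L | xpredT C) d C :> R.
      apply: eq_bigl => C; congr (_ && _); rewrite ler_nat -[X in (_ <= X)%N]card_ord.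
      exact: max_card.
    by rewrite heavy_mass; apply: le_trans hF; rewrite mulrC mul1r.
  have c16 : 0 < 1 / 16 :> R by rewrite divr_gt0.
  have [N'0] := density_low s0 l1 N0 c16 n1 h'.
  have -> : ln (1 / 16) = - ln 16 :> R by rewrite div1r lnV // posrE.
  rewrite mulrBl divff ?gt_eqF // mulNr => hd.
  have hl : ln 16 / ell <= 1 / 10 by rewrite ler_pdivrMr //; exact: hl16.
  have Y0 := density_ge0 f s.+1 L.
  have hd2 : s%:R * Y - 2 <= s%:R * density (expose a f) s L.
    by apply: le_trans hd; rewrite -[s.+1%:R]natr1; lra.
  apply: le_trans (VH _ _ L0 N'0) _; rewrite mulr1.
  have hx : psi - 2 / (c * eps) <= ln L / ell + n%:R / c * density (expose a f) s L.
    rewrite -addrA lerD2l; apply: le_trans (drift _ _ hd2); rewrite lerD2l lerN2.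
    have -> : 2 / (c * eps) = 2 / c * eps^-1 by field; rewrite !gt_eqF.
    have -> : n%:R / c / s%:R * 2 = 2 / c * (n%:R / s%:R) by field; rewrite !gt_eqF.
    by rewrite ler_wpM2l // divr_ge0 // ltW.
  apply: le_trans (Hmono _ _ hx) _.
  have hy : psi - 2 / (c * eps) <= psi + (1 / 2 - 2 * c) by rewrite lerD2l c3.
  apply: le_trans (Hlip _ _ hy) _; rewrite lerD2l ler_wpM2l //.
  by lra.
rewrite mulr0 addr0.
have gL0 : 0 < g * L by rewrite mulr_gt0 // expR_gt0.
(* The lost share consists of 2 / kap for low flags and 2 / kap for failing high ones. *)
have rho01 : 0 <= (4 / kap%:R : R) <= 1 / 2.
  by rewrite divr_ge0 //= ler_pdivrMr //; lra.
have hS : (1 - 4 / kap%:R) * total <= \sum_(C in heavy (expose a f) s (g * L)) d C :> R.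
  rewrite (eq_bigl (fun C => (C \in heavy (expose a f) s (g * L)) && xpredT C)); last first.
    by move=> C; rewrite andbT.
  rewrite heavy_mass /=.
  suff : total - \sum_(C | g * L <= `|expose a f C|) d C <= 4 / kap%:R * total :> R by lra.
  rewrite -{1}(sum_deg_heavy f s L) [X in X - _](bigID (fun C => g * L <= `|expose a f C|)) /= addrAC subrr add0r.
  have -> : 4 / kap%:R * total = 2 / kap%:R * total + 2 / kap%:R * total :> R by field; rewrite gt_eqF.
  rewrite (bigID (fun C => d C < t :> R)) /=; apply: lerD.
    apply: le_trans (ltW hm); rewrite /m [leLHS]big_mkcond [leRHS]big_mkcond; apply: ler_sum => C _.
    case: (d C < t :> R); rewrite ?andbF //=; case: ifP => // _; exact: ler0n.
  apply: le_trans hG; rewrite le_eqVlt; apply/orP; left; apply/eqP; apply: eq_bigl => C.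
  by rewrite -ltNge -leNgt andbC.
have [N'0 hd] := density_high s0 l1 N0 rho01 hS.
apply: le_trans (VH _ _ gL0 N'0) _; apply: Hmono.
rewrite lnM ?posrE ?expR_gt0 // expRK.
have := drift _ _ hd.
have -> : ((1 / 2 - c) * ell + ln L) / ell = 1 / 2 - c + ln L / ell by field; rewrite gt_eqF.
(* The size of [kap] keeps the density loss below c in psi; the gain 1/2 - c of ln L / ell then
   leaves 1/2 - 2c. *)
have : n%:R / c / s%:R * (4 * (4 / kap%:R)) <= c.
  have -> : n%:R / c / s%:R * (4 * (4 / kap%:R)) = 16 / c / kap%:R * (n%:R / s%:R) :> R.
    by field; rewrite !gt_eqF.
  apply: (@le_trans _ _ (16 / c / kap%:R * eps^-1)).
    by rewrite ler_wpM2l // !divr_ge0 // ltW.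
  have -> : 16 / c / kap%:R * eps^-1 = 16 / (c ^+ 2 * eps) * c / kap%:R by field; rewrite !gt_eqF.
  by rewrite ler_pdivrMr // [c * _]mulrC ler_pM2r.
by lra.
Qed.

End GrowthStep.

(** * Iterating the growth step *)

Section GrowthInduction.
Variables (m kap : nat) (c eps r D del Lt : R).
Local Notation gam := (1 / 2 - 2 * c).
Local Notation e2 := (D^-1 * (2 / (c * eps) + 1 / 2) * (expR (- (c / 2 * ell)) * kap%:R)).
Local Notation Lam := (ln Lt / ell + n%:R / c + D).

(** As the density is at most 1, a final psi of at least ln Lt / ell + n / c forces L >= Lt. The
    middle term is the shortfall of psi after k gains of [gam], cut at 0 and divided by [D]. The
    slack [D] inside [Lam] makes it at least 1 if L ends below [Lt], and its Lipschitz constant is 1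
    / D. *)
Lemma pfail_growth k f (L : R) :
  (0 < m)%N -> (m + k <= n)%N -> 0 < L -> (0 < #|heavy f (m + k) L|)%N ->
  0 < c -> c <= 1 / 4 -> 0 < eps -> eps <= 1 -> eps * n%:R <= m%:R ->
  0 <= r <= 1 -> 97 / 108 <= r ^+ kap -> (8 <= kap)%N ->
  16 / (c ^+ 2 * eps) <= kap%:R ->
  1 <= ell -> ln (16 * 100) <= ell / 10 -> 1 - ln eps + ln (8 * kap%:R) <= c / 2 * ell ->
  0 < D -> 0 < Lt -> 0 <= del ->
  (forall f' (L' : R), 0 < L' -> Lt <= L' -> (0 < #|heavy f' m L'|)%N -> pfail Lt m f' <= del) ->
  pfail Lt (m + k) f <= del
    + Num.max 0 (Lam - k%:R * gam - (ln L / ell + n%:R / c * density f (m + k) L)) / D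
    + \sum_(i < k) (e2 + 2 * r ^+ (m + i).+1).
Proof.
move=> m0 + L0 N0 c0 c4 e0 e1 em r01 rk k8 kbig l1 l1600 lbig D0 Lt0 del0 base.
have l0 : 0 < ell by apply: lt_le_trans l1.
have r0 : 0 <= r by case/andP: r01.
have e20 : 0 <= e2.
  apply: mulr_ge0; last by rewrite mulr_ge0 ?expR_ge0.
  apply: mulr_ge0; first by rewrite invr_ge0 ltW.
  by rewrite addr_ge0 // divr_ge0 // mulr_ge0 // ltW.
have S0 j : 0 <= \sum_(i < j) (e2 + 2 * r ^+ (m + i).+1).
  by apply: sumr_ge0 => i _; rewrite addr_ge0 // mulr_ge0 // exprn_ge0.
elim: k f L L0 N0 => [|k IH] f L L0 N0 mk.
  rewrite addn0 in N0 *; rewrite big_ord0 mul0r subr0 addr0.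
  have [LL|LL] := leP Lt L.
    apply: le_trans (base _ _ L0 LL N0) _; rewrite lerDl divr_ge0 ?(ltW D0) //.
    by rewrite le_max lexx.
  apply: le_trans (pfail_le1 _ _ _) _; rewrite -[leLHS]add0r lerD // ler_pdivlMr // mul1r.
  rewrite le_max; apply/orP; right.
  have : ln L / ell <= ln Lt / ell by rewrite ler_pM2r ?invr_gt0 // ler_ln ?posrE // ltW.
  have nc0 : 0 <= n%:R / c by rewrite divr_ge0 // ltW.
  have : n%:R / c * density f m L <= n%:R / c * 1 by rewrite ler_wpM2l // density_le1.
  by lra.
pose Hk x := del + Num.max 0 (Lam - k%:R * gam - x) / D + \sum_(i < k) (e2 + 2 * r ^+ (m + i).+1).
rewrite addnS in N0 mk *.
have mk0 : (0 < m + k)%N by rewrite addn_gt0 m0.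
have emk : eps * n%:R <= (m + k)%:R by apply: le_trans em _; rewrite ler_nat leq_addr.
have D0i : 0 <= D^-1 by rewrite invr_ge0 ltW.
have Hk0 x : 0 <= Hk x.
  rewrite /Hk !addr_ge0 // divr_ge0 ?(ltW D0) // le_max lexx //.
have Hmono (x y : R) : x <= y -> Hk y <= Hk x.
  move=> xy; rewrite /Hk lerD2r lerD2l ler_wpM2r // ge_max !le_max lexx /=.
  by apply/orP; right; lra.
have Hlip (x y : R) : x <= y -> Hk x <= Hk y + D^-1 * (y - x).
  move=> xy; rewrite /Hk [leRHS]addrAC lerD2r -[leRHS]addrA lerD2l [D^-1 * _]mulrC -mulrDl ler_wpM2r //.
  rewrite ge_max; apply/andP; split.
    by rewrite addr_ge0 ?le_max ?lexx // subr_ge0.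
  have : Lam - k%:R * gam - y <= Num.max 0 (Lam - k%:R * gam - y) by rewrite le_max lexx orbT.
  by lra.
have := @growth_step f (m + k) L c eps r D^-1 kap (pfail Lt (m + k)) Hk L0 mk0 (ltnW mk) N0
  c0 c4 e0 e1 emk r01 rk k8 kbig l1 l1600 lbig D0i Hk0 Hmono Hlip (pfail_le1 Lt (m + k))
  (fun f' L' L'0 N'0 => IH f' L' L'0 N'0 (ltnW mk)).
move=> h; apply: le_trans h _.
rewrite big_ord_recr /= /Hk.
have -> : Lam - k.+1%:R * gam - (ln L / ell + n%:R / c * density f (m + k).+1 L)
  = Lam - k%:R * gam - (ln L / ell + n%:R / c * density f (m + k).+1 L + gam).
  by rewrite -natr1; ring.
by rewrite !addrA.
Qed.

End GrowthInduction.
End Growth.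
(** * Asymptotics *)

Section Estimates.
Variable R : realType.

Lemma bernoulli_pow (x : R) (k : nat) : 0 <= x <= 1 -> 1 - k%:R * x <= (1 - x) ^+ k.
Proof.
move=> /andP[x0 x1]; elim: k => [|k IH]; first by rewrite mul0r subr0 expr0.
rewrite exprS; apply: (@le_trans _ _ ((1 - x) * (1 - k%:R * x))); last first.
  by rewrite ler_wpM2l // subr_ge0.
have : 0 <= k%:R * x ^+ 2 by rewrite mulr_ge0 // sqr_ge0.
by rewrite -[k.+1%:R]natr1; nra.
Qed.

Lemma exists_rate (k : nat) : (0 < k)%N ->
  exists r : R, [/\ 0 <= r, r < 1 & 97 / 108 <= r ^+ k].
Proof.
move=> k0; have k0R : 0 < k%:R :> R by rewrite ltr0n.
have k1R : 1 <= k%:R :> R by rewrite ler1n.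
(* Then k x = 1/20, and 19/20 exceeds 97/108. *)
pose x : R := (20 * k%:R)^-1.
have x0 : 0 < x by rewrite invr_gt0 mulr_gt0.
have kx : k%:R * x = 1 / 20 by rewrite /x; field; rewrite gt_eqF.
have x1 : x <= 1 by nra.
exists (1 - x); split; [lra|lra|].
have x01 : 0 <= x <= 1 by rewrite ltW.
by have := bernoulli_pow k x01; rewrite kx; lra.
Qed.

Lemma geo_small (r e : R) : 0 <= r -> r < 1 -> 0 < e ->
  exists s : nat, forall s', (s <= s')%N -> r ^+ s' <= e.
Proof.
move=> r0 r1 e0.
have h : `|r| < 1 by rewrite ger0_norm.
have /cvgrPdist_le/(_ e e0) [s _ hs] := cvg_expr h.
exists s => s' ss'; have := hs s' ss'; rewrite /= sub0r normrN ger0_norm //.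
exact: exprn_ge0.
Qed.

Lemma geo_sum (r : R) (a k : nat) : 0 <= r -> r < 1 ->
  \sum_(i < k) r ^+ (a + i).+1 <= r ^+ a / (1 - r).
Proof.
move=> r0 r1; have r10 : 0 < 1 - r by rewrite subr_gt0.
suff -> : \sum_(i < k) r ^+ (a + i).+1 = (r ^+ a.+1 - r ^+ (a + k).+1) / (1 - r).
  rewrite ler_pM2r ?invr_gt0 //.
  apply: (@le_trans _ _ (r ^+ a.+1)); first by rewrite lerBlDr lerDl exprn_ge0.
  by rewrite exprS ler_piMl ?exprn_ge0 // ltW.
elim: k => [|k IH]; first by rewrite big_ord0 addn0 subrr mul0r.
rewrite big_ord_recr /= IH addnS [r ^+ (a + k).+2]exprS; field.
by rewrite gt_eqF.
Qed.

(** The term 1 / (j + 1) is at most ln (j + 1) - ln j, and these differences telescope. *)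
Lemma harmonic_le_ln (s k : nat) : (0 < s)%N ->
  \sum_(i < k) ((s + i).+1%:R)^-1 <= ln (s + k)%:R :> R.
Proof.
move=> s0; elim: k => [|k IH]; first by rewrite big_ord0 ln_ge0 // ler1n addn0.
rewrite big_ord_recr /= addnS; set j := (s + k)%N in IH *.
have j0 : (0 < j)%N by rewrite addn_gt0 s0.
have j0R : 0 < j%:R :> R by rewrite ltr0n.
have j1R : 0 < j.+1%:R :> R by rewrite ltr0n.
have q0 : 0 < j%:R / j.+1%:R :> R by rewrite divr_gt0.
have := ln_le_subr1 q0; rewrite ln_div ?posrE //.
have -> : j%:R / j.+1%:R - 1 = - (j.+1%:R)^-1 :> R.
  have -> : j%:R = j.+1%:R - 1 :> R by rewrite -natr1 addrK.
  by rewrite mulrBl divff ?gt_eqF // mul1r addrAC subrr add0r.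
move=> h; apply: le_trans (lerD IH (lexx _)) _.
by move: h; move: (j.+1%:R^-1) (ln j.+1%:R) (ln j%:R) => u v x; lra.
Qed.

(** Quadratic decay beats the factor ln n of the harmonic sum; 400 is the square of 20, from exp (x
    / 20) >= x / 20. *)
Lemma exp_decay (x : R) : 0 < x -> expR (- (x / 10)) <= 400 / x ^+ 2.
Proof.
move=> x0; have h : x / 20 <= expR (x / 20).
  by apply: le_trans (expR_ge1Dx _); rewrite lerDr.
have e0 := expR_gt0 (x / 20).
have -> : - (x / 10) = - (x / 20 + x / 20) by field.
rewrite expRN expRD -[leLHS]div1r ler_pdivrMr ?mulr_gt0 //.
rewrite mulrAC ler_pdivlMr ?exprn_gt0 // mul1r.
have : (x / 20) * (x / 20) <= expR (x / 20) * expR (x / 20).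
  by apply: ler_pM => //; lra.
by rewrite expr2; lra.
Qed.

Lemma fixed_error_ge0 (n : nat) (r : R) (s0 k : nat) : 0 <= r -> 0 <= fixed_error n r s0 k.
Proof.
move=> r0; have h : 0 <= 2 / expR (ln n%:R / 4) / expR (- (ln n%:R / 10)) :> R.
  by rewrite !divr_ge0 ?expR_ge0.
apply: addr_ge0; first apply: addr_ge0.
- by rewrite divr_ge0 ?expR_ge0.
- by rewrite mulr_ge0 // addr_ge0 // !mulr_ge0 ?expR_ge0.
apply: sumr_ge0 => i _; apply: addr_ge0; last by rewrite mulr_ge0 // exprn_ge0.
by apply: mulr_ge0; [rewrite divr_ge0 // mulr_ge0|rewrite addr_ge0 // mulr_ge0 ?expR_ge0].
Qed.

(** Both p and p / tau = 2 n^(-3/20) are at most 2 tau, and the harmonic sum is at most ln n. For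
    fixed s0 everything but the geometric part is thus of order tau ln n. *)
Lemma fixed_error_bound (n : nat) (r : R) (s0 k : nat) : 0 <= r -> r < 1 ->
  (3 <= s0)%N -> (s0 + k <= n)%N -> 1 <= ln n%:R :> R ->
  fixed_error n r s0 k <=
   400 * (2 + s0%:R * (32 * s0%:R + 2) + 48 * s0%:R) / ln n%:R + 4 * (r ^+ s0 / (1 - r)).
Proof.
move=> r0 r1 s03 skn l1; rewrite /fixed_error.
set l := ln n%:R in l1 *; set tau := expR (- (l / 10)).
have l0 : 0 < l by apply: lt_le_trans l1.
have tau0 : 0 < tau by exact: expR_gt0.
have hp : 2 / expR (l / 4) <= 2 * tau.
  by rewrite -expRN ler_pM2l // ler_expR; lra.
have hpt : 2 / expR (l / 4) / tau <= 2 * tau.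
  rewrite ler_pdivrMr // -expRN -mulrA ler_pM2l // -expRD ler_expR; lra.
have s0R : 0 < s0%:R :> R by rewrite ltr0n (leq_trans _ s03).
set p := 2 / expR (l / 4) in hp hpt *.
rewrite big_split /= -mulr_sumr -!mulr_suml -!mulr_sumr.
have h1 : \sum_(i < k) ((s0 + i)%:R)^-1 <= l :> R.
  have e : s0 = s0.-1.+1 by rewrite prednK // (leq_trans _ s03).
  have s1 : (0 < s0.-1)%N by rewrite -ltnS -e (leq_trans _ s03).
  rewrite e; under eq_bigr do rewrite addSn.
  apply: le_trans (harmonic_le_ln k s1) _.
  have n0 : (0 < n)%N by apply: leq_trans skn; rewrite addn_gt0 (leq_trans _ s03).
  rewrite /l ler_ln ?posrE ?ltr0n ?addn_gt0 ?s1 // ler_nat.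
  by apply: leq_trans skn; rewrite leq_add2r leq_pred.
have h2 := geo_sum s0 k r0 r1.
set Hs := \sum_(i < k) _ in h1; set Gs := \sum_(i < k) _ in h2.
rewrite -/Hs -/Gs.
have Hs0 : 0 <= Hs by apply: sumr_ge0 => i _; rewrite invr_ge0.
have hH : 4 * s0%:R * Hs * (8 * tau + 2 * (p / tau)) <= 4 * s0%:R * l * (12 * tau).
  have p0 : 0 <= p / tau by rewrite !divr_ge0 ?expR_ge0.
  apply: ler_pM; [by rewrite !mulr_ge0| | |by lra].
    by apply: addr_ge0; apply: mulr_ge0 => //; exact: ltW.
  by rewrite ler_pM2l // mulr_gt0.
have hS : s0%:R * (4 * s0%:R * (8 * tau) + p / tau) <= s0%:R * ((32 * s0%:R + 2) * tau).
  by rewrite ler_pM2l //; lra.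
have hd : tau <= 400 / l ^+ 2 by exact: exp_decay.
set B := 2 + s0%:R * (32 * s0%:R + 2) + 48 * s0%:R.
have hB : tau * (2 + s0%:R * (32 * s0%:R + 2) + 48 * s0%:R * l) <= 400 * B / l.
  apply: (@le_trans _ _ (400 / l ^+ 2 * (B * l))).
    apply: ler_pM => //; first by exact: ltW.
      by rewrite !addr_ge0 // !mulr_ge0 ?addr_ge0 ?mulr_ge0 // ltW.
    rewrite /B !mulrDl lerD2r; apply: lerD; first by lra.
    by rewrite ler_peMr // mulr_ge0 ?addr_ge0 ?mulr_ge0.
  rewrite le_eqVlt; apply/orP; left; apply/eqP; field.
  by rewrite gt_eqF.
by lra.
Qed.

End Estimates.

(** * Choice of the constants and the lower tail *)

Section StartState.
Variable R : realType.

(** The state before any row: the empty permanent is 1, and it occurs only when no column has been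
    used. *)
Definition start n (B : {set 'I_n}) : R := (B == setT)%:R.

Lemma pfail_mono n (Lt Lt' : R) s (f : {set 'I_n} -> R) : Lt <= Lt' ->
  pfail Lt s f <= pfail Lt' s f.
Proof.
move=> h; elim: s f => [|s IH] f /=; last by apply: ler_avg.
by case: ltP => //= h2; rewrite (lt_le_trans h2 h).
Qed.

Lemma start_heavy n : (0 < #|heavy (@start n) n 1|)%N.
Proof. by apply/card_gt0P; exists setT; rewrite inE cardsT card_ord eqxx /start eqxx normr1 lexx. Qed.

(** Growth during the first n - m rows, with m between eps n / 8 and eps n / 4, then a fixed
    threshold. Five error terms remain, each at most del / 8. *)
Lemma pfail_start_bound (n m kap s0 : nat) (eps c e1 r1 r2 del : R) :
  0 < eps -> eps <= 1 -> 0 < del -> c = eps / 16 -> e1 = eps / 8 ->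
  (8 <= kap)%N -> 16 / (c ^+ 2 * e1) <= kap%:R ->
  0 <= r1 -> r1 < 1 -> 97 / 108 <= r1 ^+ kap ->
  0 <= r2 -> r2 < 1 -> 97 / 108 <= r2 ^+ 200 ->
  (3 <= s0)%N -> (s0 <= m)%N -> (m <= n)%N -> e1 * n%:R <= m%:R -> m%:R <= 2 * (e1 * n%:R) ->
  r2 ^+ s0 <= del / 8 * (1 - r2) / 4 -> r1 ^+ m <= del / 8 * (1 - r1) / 2 ->
  1 <= ln n%:R :> R -> 10 * ln (16 * 100) <= ln n%:R :> R ->
  (1 - ln e1 + ln (8 * kap%:R)) * (2 / c) <= ln n%:R ->
  8 / (c * eps) <= ln n%:R -> 32 * s0%:R * (1 - ln e1) / del <= ln n%:R ->
  8 * (400 * (2 + s0%:R * (32 * s0%:R + 2) + 48 * s0%:R)) / del <= ln n%:R ->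
  8 * (4 / eps * (2 / (c * e1) + 1 / 2) * kap%:R * (2 / c)) / del <= ln n%:R ->
  pfail (n%:R `^ ((2^-1 - eps) * n%:R)) n (@start n) <= del.
Proof.
move=> ep0 ep1 del0 ec ee1 k8 kbig r10 r11 r1k r20 r21 r2k s03 s0m mn em me hr2 hr1
  l1 lx1 lx2 lx3 lx4 lx5 lx6.
have c0 : 0 < c by rewrite ec divr_gt0.
have c4 : c <= 1 / 4 by rewrite ec; move: ep1; clear; lra.
have e10 : 0 < e1 by rewrite ee1 divr_gt0.
have e11 : e1 <= 1 by rewrite ee1; move: ep1; clear; lra.
have l0 : 0 < ln n%:R :> R by apply: lt_le_trans l1.
have n0 : (0 < n)%N by apply: leq_trans mn; apply: leq_trans s0m; exact: leq_trans s03.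
have n0R : 0 < n%:R :> R by rewrite ltr0n.
have m0 : (0 < m)%N by apply: leq_trans s0m; exact: leq_trans s03.
set l := ln n%:R in l1 lx1 lx2 lx3 lx4 lx5 lx6 l0 *.
set Lt := n%:R `^ _.
have Lt0 : 0 < Lt by rewrite powR_gt0.
have lnLt : ln Lt / l = (2^-1 - eps) * n%:R.
  by rewrite /Lt ln_powR mulfK // gt_eqF.
have l1600 : ln (16 * 100) <= l / 10 by move: lx1; clear; lra.
have tau4 : expR (- (l / 10)) <= 1 / 4.
  rewrite expRN div1r lef_pV2 ?posrE ?expR_gt0 //.
  rewrite -[leLHS]lnK ?posrE // ler_expR; apply: le_trans (ln4_le R) l1600.
have r101 : 0 <= r1 <= 1 by rewrite r10 ltW.
have r201 : 0 <= r2 <= 1 by rewrite r20 ltW.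
(* Failure bound for the last m rows: as m >= e1 n, a single heavy set already gives density 1 - (1
   - ln e1) / l. *)
pose del2 := 4 * s0%:R * ((1 - ln e1) / l) + fixed_error n r2 s0 (m - s0).
have lbig : 1 - ln e1 + ln (8 * kap%:R) <= c / 2 * l.
  have : (1 - ln e1 + ln (8 * kap%:R)) * (2 / c) * (c / 2) <= l * (c / 2).
    by rewrite ler_pM2r // divr_gt0.
  have -> : (1 - ln e1 + ln (8 * kap%:R)) * (2 / c) * (c / 2) = 1 - ln e1 + ln (8 * kap%:R).
    by field; rewrite gt_eqF.
  by rewrite [l * _]mulrC.
have base (f' : {set 'I_n} -> R) (L' : R) : 0 < L' -> Lt <= L' -> (0 < #|heavy f' m L'|)%N -> pfail Lt m f' <= del2.
  move=> L'0 hL N0; have em' : (s0 + (m - s0) = m)%N by rewrite subnKC.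
  have := pfail_many_rows r201 r2k l1 l1600 s03 L'0 hL tau4 (m - s0) f'.
  rewrite em' => h; apply: le_trans h _; rewrite /del2 lerD2r ler_pM2l; last first.
    by rewrite mulr_gt0 // ltr0n (leq_trans _ s03).
  have := density_lower_bound m0 l0 e10 em N0.
  by rewrite -/l; clear; lra.
have smn : (s0 + (m - s0) <= n)%N by rewrite subnKC.
have fe := fixed_error_bound r20 r21 s03 smn l1; rewrite -/l in fe.
have x4 : 4 * s0%:R * ((1 - ln e1) / l) <= del / 8.
  rewrite mulrA ler_pdivrMr //; move: lx4; rewrite ler_pdivrMr //; clear; lra.
have x5 : 400 * (2 + s0%:R * (32 * s0%:R + 2) + 48 * s0%:R) / l <= del / 8.
  rewrite ler_pdivrMr //; move: lx5; rewrite ler_pdivrMr //.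
  by move: (400 * _) => K; clear; lra.
have g2 : 4 * (r2 ^+ s0 / (1 - r2)) <= del / 8.
  rewrite mulrA ler_pdivrMr ?subr_gt0 //; move: hr2; clear; lra.
have del23 : del2 <= 3 * (del / 8) by rewrite /del2; move: fe x4 x5 g2; clear; lra.
have del20 : 0 <= del2.
  apply: addr_ge0; last exact: fixed_error_ge0.
  apply: mulr_ge0; [by rewrite mulr_ge0|apply: divr_ge0; last exact: ltW].
  by have := ln_le0 e11; clear; lra.
pose D := eps * n%:R / 4.
have D0 : 0 < D by rewrite divr_gt0 // mulr_gt0.
have N1 : (0 < #|heavy (@start n) (m + (n - m)) 1|)%N by rewrite subnKC // start_heavy.
have := @pfail_growth R n m kap c e1 r1 D del2 Lt (n - m) (@start n) 1 m0 _ ltr01 N1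
  c0 c4 e10 e11 em r101 r1k k8 kbig l1 l1600 lbig D0 Lt0 del20 base.
rewrite subnKC // => /(_ (leqnn _)) h; apply: le_trans h _.
rewrite ln1 mul0r add0r -/l lnLt.
(* There is no shortfall: out of eps n, [D] takes eps n / 4, while the initial density, the m
   omitted rows and the loss 2c per row take at most eps n / 8 each. *)
rewrite max_l; last first.
  have hY : 1 - (1 - ln 1) / l <= density (@start n) n 1.
    apply: density_lower_bound => //; [by rewrite mul1r|exact: start_heavy].
  rewrite ln1 subr0 in hY.
  have nc0 : 0 <= n%:R / c by rewrite divr_ge0 // ltW.
  have hY2 : n%:R / c - n%:R / c / l <= n%:R / c * density (@start n) n 1.
    by have := ler_wpM2l nc0 hY; rewrite mulrBr mulr1 mul1r.
  have hl : n%:R / c / l <= n%:R * (eps / 8).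
    rewrite -mulrA ler_pM2l // -invfM -[leLHS]div1r ler_pdivrMr ?mulr_gt0 //.
    move: lx3; rewrite ler_pdivrMr ?mulr_gt0 //.
    have -> : eps / 8 * (c * l) = l * (c * eps) / 8 by ring.
    by move: (l * (c * eps)) => w; clear; lra.
  have hk : (n - m)%:R = n%:R - m%:R :> R by rewrite natrB.
  have hm : m%:R * (1 / 2 - 2 * c) <= n%:R * (eps / 8).
    have : m%:R * (1 / 2 - 2 * c) <= m%:R * (1 / 2).
      by rewrite ler_wpM2l //; move: c0; clear; lra.
    by move: me; rewrite ee1; clear; lra.
  have hc : n%:R * (2 * c) = n%:R * (eps / 8) by rewrite ec; field.
  have npe : 0 <= n%:R * eps by rewrite mulr_ge0 // ltW.
  rewrite hk /D; move: hY2 hl hm hc npe; clear; lra.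
rewrite mul0r addr0 big_split /= sumr_const card_ord -mulr_sumr.
have g1 : 2 * \sum_(i < n - m) r1 ^+ (m + i).+1 <= del / 8.
  have := geo_sum m (n - m) r10 r11 => h.
  apply: (@le_trans _ _ (2 * (r1 ^+ m / (1 - r1)))); first by rewrite ler_pM2l.
  rewrite mulrA ler_pdivrMr ?subr_gt0 //; move: hr1; clear; lra.
have ge2 : (D^-1 * (2 / (c * e1) + 1 / 2) * (expR (- (c / 2 * l)) * kap%:R)) *+ (n - m) <= del / 8.
  set w := 2 / (c * e1) + 1 / 2.
  have w0 : 0 <= w by rewrite addr_ge0 // divr_ge0 // mulr_ge0 // ltW.
  have ex : expR (- (c / 2 * l)) <= (2 / c) / l.
    have y0 : 0 < c / 2 * l by rewrite mulr_gt0 // divr_gt0.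
    rewrite expRN; have -> : 2 / c / l = (c / 2 * l)^-1 by field; rewrite !gt_eqF.
    rewrite lef_pV2 ?posrE ?expR_gt0 //.
    by apply: le_trans (expR_ge1Dx _); rewrite lerDr.
  apply: (@le_trans _ _ ((D^-1 * w * ((2 / c) / l * kap%:R)) * n%:R)).
    rewrite -mulr_natr; apply: ler_pM => //; last by rewrite ler_nat leq_subr.
      by rewrite !mulr_ge0 ?invr_ge0 ?expR_ge0 // ltW.
    by rewrite ler_wpM2l ?mulr_ge0 ?invr_ge0 ?(ltW D0) // ler_wpM2r.
  have -> : D^-1 * w * (2 / c / l * kap%:R) * n%:R = 4 / eps * w * kap%:R * (2 / c) / l.
    by rewrite /D; field; rewrite !gt_eqF.
  rewrite ler_pdivrMr //; move: lx6; rewrite ler_pdivrMr // -/w.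
  by move: (4 / eps * w * kap%:R * (2 / c)) => K; clear; lra.
by move: del0 del23 g1 ge2; clear; lra.
Qed.

(** The constants are fixed in the order c, e1, kap, r1, r2, s0; only then is n taken large. *)
Lemma pfail_start_small (eps del : R) : 0 < eps -> eps <= 1 -> 0 < del ->
  exists M : nat, forall n, (M <= n)%N ->
    pfail (n%:R `^ ((2^-1 - eps) * n%:R)) n (@start n) <= del.
Proof.
move=> ep0 ep1 del0.
pose c : R := eps / 16; pose e1 : R := eps / 8.
have e10 : 0 < e1 by rewrite divr_gt0.
have e11 : e1 <= 1 / 2 by rewrite /e1; lra.
pose kap := (Num.bound (16 / (c ^+ 2 * e1)) + 8)%N.
have k8 : (8 <= kap)%N by rewrite leq_addl.
have kbig : 16 / (c ^+ 2 * e1) <= kap%:R.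
  have kb0 : 0 <= 16 / (c ^+ 2 * e1) by rewrite divr_ge0 // mulr_ge0 ?sqr_ge0 // ltW.
  by apply: le_trans (ltW (archi_boundP kb0)) _; rewrite ler_nat leq_addr.
have k0 : (0 < kap)%N by exact: leq_trans k8.
have [r1 [r10 r11 r1k]] := exists_rate R k0.
have [r2 [r20 r21 r2k]] := @exists_rate R 200 isT.
have d1 : 0 < del / 8 * (1 - r2) / 4 by rewrite !mulr_gt0 ?invr_gt0 // subr_gt0.
have [sa hsa] := geo_small r20 r21 d1.
have d2 : 0 < del / 8 * (1 - r1) / 2 by rewrite !mulr_gt0 ?invr_gt0 // subr_gt0.
have [sb hsb] := geo_small r10 r11 d2.
pose s0 := (sa + 3)%N.
have s03 : (3 <= s0)%N by rewrite leq_addl.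
(* [E] collects the lower bounds required of ln n; the initial value 1 of the maximum supplies 1 <=
   ln n. *)
pose E := \big[Num.max/1]_(x <- [:: 10 * ln (16 * 100);
  (1 - ln e1 + ln (8 * kap%:R)) * (2 / c); 8 / (c * eps); 32 * s0%:R * (1 - ln e1) / del;
  8 * (400 * (2 + s0%:R * (32 * s0%:R + 2) + 48 * s0%:R)) / del;
  8 * (4 / eps * (2 / (c * e1) + 1 / 2) * kap%:R * (2 / c)) / del]) x.
pose Q : R := (s0 + sb + 1)%:R / e1.
have Q0 : 0 <= Q by rewrite divr_ge0 // ltW.
exists (Num.bound (expR E) + Num.bound Q)%N => n hn.
have nE : expR E <= n%:R.
  apply: le_trans (ltW (archi_boundP (expR_ge0 E))) _; rewrite ler_nat.
  by apply: leq_trans hn; rewrite leq_addr.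
have nQ : (s0 + sb + 1)%:R <= e1 * n%:R.
  rewrite mulrC -ler_pdivrMr //.
  apply: le_trans (ltW (archi_boundP Q0)) _; rewrite ler_nat.
  by apply: leq_trans hn; rewrite leq_addl.
have lE : E <= ln n%:R.
  rewrite -[leLHS]expRK ler_ln ?posrE ?expR_gt0 //.
  by apply: lt_le_trans nE; exact: expR_gt0.
move: lE; rewrite /E !big_cons big_nil !ge_max => /andP[lx1 /andP[lx2 /andP[lx3 /andP[lx4 /andP[lx5 /andP[lx6 l1]]]]]].
(* The least integer above e1 n, at most twice e1 n since e1 n >= 1. *)
pose m := (Num.truncn (e1 * n%:R)).+1.
have en0 : 0 <= e1 * n%:R by rewrite mulr_ge0 // ltW.
have /andP[me em] : m.-1%:R <= e1 * n%:R < m%:R := truncn_itv en0.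
have me2 : m%:R <= 2 * (e1 * n%:R).
  have : 1 <= e1 * n%:R by apply: le_trans nQ; rewrite ler1n addn1.
  by rewrite -[m%:R]natr1; move: me => /=; lra.
have mn : (m <= n)%N.
  rewrite -(ler_nat R); apply: le_trans me2 _.
  by rewrite mulrA ler_piMl //; lra.
have sm : (s0 + sb + 1 <= m)%N by rewrite -(ler_nat R); apply: le_trans nQ (ltW em).
apply: (@pfail_start_bound n m kap s0 eps c e1 r1 r2 del) => //.
- by apply: leq_trans sm; rewrite -addnA leq_addr.
- exact: ltW.
- by apply: hsa; rewrite leq_addr.
- by apply: hsb; apply: leq_trans sm; rewrite addnAC leq_addl.
Qed.

End StartState.
(** * Permanents of random sign matrices *)

Section Mean.
Variables (R : realType) (n : nat).
Local Notation state := ({set 'I_n} -> R).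

Fixpoint mean (s : nat) (G : state -> R) (f : state) : R :=
  if s is s'.+1 then avg (fun a => mean s' G (expose a f)) else G f.

Lemma pfail_mean (Lt : R) s f :
  pfail Lt s f = mean s (fun f => (`|f set0| < Lt)%R%:R) f.
Proof. by elim: s f => [|s IH] f //=; apply: eq_avg => a; rewrite IH. Qed.

Lemma eq_mean s (G H : state -> R) f : G =1 H -> mean s G f = mean s H f.
Proof. by move=> h; elim: s f => [|s IH] f //=; apply: eq_avg => a. Qed.

Lemma ler_mean s (G H : state -> R) f : (forall f, G f <= H f) -> mean s G f <= mean s H f.
Proof. by move=> h; elim: s f => [|s IH] f //=; apply: ler_avg => a. Qed.

Lemma mean_cst s (c : R) f : mean s (fun=> c) f = c.
Proof. by elim: s f => [|s IH] f /=; rewrite ?(eq_avg (fun a => IH _)) ?avg_cst. Qed.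

Lemma meanZ s (c : R) (G : state -> R) f : mean s (fun f => c * G f) f = c * mean s G f.
Proof. elim: s f => [|s IH] f //=; rewrite -avgZ; apply: eq_avg => a; exact: IH. Qed.

Lemma mean_sum s (I : finType) (P : pred I) (G : I -> state -> R) f :
  mean s (fun f => \sum_(i | P i) G i f) f = \sum_(i | P i) mean s (G i) f.
Proof. elim: s f => [|s IH] f //=; rewrite -avg_sum; apply: eq_avg => a; exact: IH. Qed.

(** The definition peels off the first row; the second moment needs the last one. *)
Lemma meanSr s (G : state -> R) f :
  mean s.+1 G f = mean s (fun f => avg (fun a => G (expose a f))) f.
Proof. by elim: s f => [|s IH] f //=; apply: eq_avg => a; rewrite -IH. Qed.

Lemma avg_sgn2 (i j : 'I_n) : avg (fun a => sgn R a i * sgn R a j) = (i == j)%:R.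
Proof.
have [->|ij] := eqVneq i j.
  rewrite -[RHS](@avg_cst R 'I_n); apply: eq_avg => a; rewrite /sgn.
  by case: ifP; rewrite ?mulr1 ?mulrNN ?mulr1.
rewrite mulr0n; set X := avg _; suff : X = - X by move=> h; lra.
rewrite {1}/X -(avg_flip i) /X -[RHS]mulN1r -avgZ; apply: eq_avg => a.
rewrite /sgn !inE eqxx eq_sym (negbTE ij) addbT addbF.
by case: (i \in a); case: (j \in a) => /=; ring.
Qed.

(** Cross terms vanish because distinct signs are orthogonal, by [avg_sgn2]. *)
Lemma avg_expose_sqr (f : state) (C : {set 'I_n}) :
  avg (fun a => (expose a f C) ^+ 2) = \sum_(j | j \notin C) (f (j |: C)) ^+ 2.
Proof.
transitivity (avg (fun a => \sum_(i | i \notin C) \sum_(j | j \notin C)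
    (f (i |: C) * f (j |: C)) * (sgn R a i * sgn R a j))).
  apply: eq_avg => a; rewrite expr2 /expose mulr_suml; apply: eq_bigr => i _.
  by rewrite mulr_sumr; apply: eq_bigr => j _; ring.
rewrite avg_sum; apply: eq_bigr => i iC; rewrite avg_sum (bigD1 i) //= big1 ?addr0 => [|j /andP[_ ji]].
  by rewrite avgZ avg_sgn2 eqxx mulr1 expr2.
by rewrite avgZ avg_sgn2 eq_sym (negbTE ji) mulr0.
Qed.

(** Expansion along the last exposed row: each of the k + 1 columns outside [C] contributes k! by
    induction. *)
Lemma mean_sqr k (C : {set 'I_n}) : (#|C| + k = n)%N ->
  mean k (fun f => f C ^+ 2) (@start R n) = k`!%:R.
Proof.
elim: k C => [|k IH] C hC.
  rewrite /= /start; have -> : C = setT; last by rewrite eqxx expr1n.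
  apply/eqP; rewrite eqEcard finset.subsetT cardsT card_ord /=.
  by apply: eq_leq; rewrite -[LHS]hC addn0.
rewrite meanSr (eq_mean _ _ (avg_expose_sqr ^~ C)) mean_sum.
rewrite (eq_bigr (fun=> k`!%:R)) => [|j jC]; last first.
  by rewrite IH // cardsU1 jC add1n addSnnS.
rewrite sumr_const factS natrM mulr_natl; congr (_ *+ _).
have -> : #|[pred j | j \notin C]| = #|~: C| by apply: eq_card => j; rewrite !inE.
by rewrite cardsCs setCK card_ord; lia.
Qed.

Lemma big_tuple_cons (A : finType) k (V : nmodType) (F : k.+1.-tuple A -> V) :
  \sum_(t : k.+1.-tuple A) F t = \sum_(a : A) \sum_(t : k.-tuple A) F [tuple of a :: t].
Proof.
rewrite pair_big /= (reindex (fun p : A * k.-tuple A => [tuple of p.1 :: p.2])) //=.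
exists (fun t : k.+1.-tuple A => (thead t, [tuple of behead t])) => [[a t] _|t _] /=.
  by congr (_, _); apply: val_inj.
by rewrite -tuple_eta.
Qed.

Definition run (f : state) (rows : seq {set 'I_n}) : state :=
  foldl (fun g a => expose a g) f rows.

Lemma mean_tuples k (G : state -> R) f :
  mean k G f = (\sum_(t : k.-tuple {set 'I_n}) G (run f t)) / (2 ^+ n) ^+ k.
Proof.
elim: k f => [|k IH] f /=.
  rewrite expr0 divr1 (big_pred1 [tuple]) // => t; apply/esym/eqP; exact: tuple0.
rewrite /avg card_ord big_tuple_cons exprSr invfM mulrA; congr (_ / _).
rewrite mulr_suml; apply: eq_bigr => a _; rewrite IH; congr (_ / _).
Qed.

(** The Laplace expansion iterated: [c] lists the columns chosen by the successive rows, and f is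
    evaluated where these columns are put back. *)
Lemma run_sum k (t : k.-tuple {set 'I_n}) f (C : {set 'I_n}) :
  run f t C = \sum_(c : k.-tuple 'I_n | uniq c && all (fun j => j \notin C) c)
     (\prod_(i < k) sgn R (tnth t i) (tnth c i)) * f ([set x in c] :|: C).
Proof.
elim: k t f C => [|k IH] t f C.
  rewrite (tuple0 t) /= (big_pred1 [tuple]) => [|c]; last by rewrite (tuple0 c) /= eqxx.
  rewrite big_ord0 mul1r; congr (f _).
  by apply/setP => x; rewrite !inE.
case/tupleP: t => a t; transitivity (run (expose a f) t C); first by [].
rewrite IH.
rewrite [RHS]big_mkcond big_tuple_cons exchange_big /= [LHS]big_mkcond /=.
apply: eq_bigr => c _; case: ifP => [/andP[uc ac]|huc]; last first.
  rewrite big1 // => j _; case: ifP => // /andP[/andP[_ uc] /andP[_ ac]].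
  by rewrite uc ac in huc.
rewrite /expose mulr_sumr big_mkcond; apply: eq_bigr => j _.
rewrite uc ac !andbT !inE negb_or; case: ifP => // _.
rewrite big_ord_recl !tnth0.
have -> : [set x in j :: c] :|: C = j |: ([set x in c] :|: C).
  by rewrite set_cons setUA.
rewrite mulrCA mulrA; congr (_ * _ * _).
by apply: eq_bigr => i _; rewrite !tnthS.
Qed.

Lemma run_permanent (t : n.-tuple {set 'I_n}) :
  run (@start R n) t set0 = permanent (\matrix_(i, j) sgn R (tnth t i) j).
Proof.
rewrite run_sum /permanent.
rewrite (eq_bigl (fun c : n.-tuple 'I_n => uniq c)) => [|c]; last first.
  rewrite (@eq_all _ _ predT) ?all_predT ?andbT // => j; by rewrite inE.
pose h (s : 'S_n) : n.-tuple 'I_n := [tuple s i | i < n].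
(* The default value of [insubd] is never reached on a tuple without repetition. *)
pose h' (c : n.-tuple 'I_n) : 'S_n := insubd (1%g : 'S_n) [ffun i => tnth c i].
rewrite (reindex h) /=; last first.
  exists h' => [s _|c /= uc].
    apply: val_inj; rewrite /h' val_insubd; case: ifP => [_|].
      apply/ffunP => i; rewrite ffunE tnth_mktuple.
      by rewrite -pvalE.
    move/negbT/injectiveP => []; move=> i j; rewrite !ffunE !tnth_mktuple; exact: perm_inj.
  apply: eq_from_tnth => i; rewrite tnth_mktuple.
  have inj : injectiveb [ffun i => tnth c i].
    apply/injectiveP => x y; rewrite !ffunE => /tuple_uniqP; exact.
  by rewrite -pvalE /= /h' val_insubd inj ffunE.
apply: eq_big => [s|s _].
  by rewrite map_inj_uniq ?enum_uniq //; exact: perm_inj.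
have -> : [set x in h s] :|: set0 = setT.
  apply/setP => x; rewrite !inE orbF; apply/mapP; exists (s^-1%g x); rewrite ?mem_enum //.
  by rewrite permKV.
rewrite /start eqxx mulr1; apply: eq_bigr => i _.
by rewrite mxE tnth_mktuple.
Qed.

End Mean.

(** * From nested averages to the probability space *)

Section Transfer.
Variables (R : realType) (n : nat).

(** Markov for the square, whose mean is n! by [mean_sqr]. *)
Lemma mean_large_values (Lt : R) : 0 < Lt ->
  mean n (fun f => (Lt < `|f set0|)%R%:R) (@start R n) <= n`!%:R / Lt ^+ 2.
Proof.
move=> L0; rewrite mulrC -(@mean_sqr R n n set0) ?cards0 // -meanZ; apply: ler_mean => f.
have L2 : 0 < Lt ^+ 2 by rewrite exprn_gt0.
case: ltP => h /=; last by rewrite mulr_ge0 ?sqr_ge0 // invr_ge0 ltW.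
rewrite ler_pdivlMl // mulr1 -[leRHS]real_normK ?num_real //.
by rewrite ler_pXn2r ?nnegrE ?ltW // (lt_trans L0 h).
Qed.

Variables (d : measure_display) (T : measurableType d) (P : probability T R).
Variable (X : 'I_n * 'I_n -> {RV P >-> R}).
Local Open Scope classical_set_scope.

(** The event that the matrix shows the sign pattern [t], written as an intersection over all
    entries so that independence applies directly. *)
Definition cell (t : n.-tuple {set 'I_n}) : set T :=
  \bigcap_(ij in [set` [set: 'I_n * 'I_n]%SET])
     (X ij @^-1` [set sgn R (tnth t ij.1) ij.2]).

Lemma cellP t w : cell t w -> forall i j, X (i, j) w = sgn R (tnth t i) j.
Proof. by move=> h i j; apply: (h (i, j)); rewrite /= inE. Qed.

Lemma measurable_cell t : measurable (cell t).
Proof.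
apply: fin_bigcap_measurable => [|ij _]; first exact: finite_finset.
by rewrite -[X in measurable X]classical_sets.setTI; apply: measurable_funP.
Qed.

Lemma cell_prob t : mutually_independent X -> (forall ij, rademacher (X ij)) ->
  P (cell t) = (((2 ^+ n) ^+ n)^-1)%:E.
Proof.
move=> hI hR; rewrite /cell hI; last by move=> i _; exact: measurable_set1.
rewrite (eq_bigr (fun=> (2^-1)%:E)) => [|ij _]; last first.
  have [h1 h2] := hR ij; rewrite /sgn; case: ifP => _ //.
rewrite prodEFin prodr_const cardsT card_prod card_ord -exprM exprVn.
by [].
Qed.

Lemma cell_trivI (D : set (n.-tuple {set 'I_n})) : classical_sets.trivIset D cell.
Proof.
move=> t u _ _ [w [/cellP ht /cellP hu]]; apply: eq_from_tnth => i; apply/setP => j.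
have := ht i j; rewrite hu /sgn; case: (j \in tnth t i); case: (j \in tnth u i) => //= h; exfalso; lra.
Qed.

Lemma cell_matrix t w : cell t w ->
  permanent (random_matrix X w) = run (@start R n) t finset.set0.
Proof.
move=> /cellP h; rewrite run_permanent; congr permanent.
by apply/matrixP => i j; rewrite !mxE h.
Qed.

Lemma measurable_permanent :
  measurable_fun [set: T] (fun w => permanent (random_matrix X w)).
Proof.
rewrite /permanent; apply: measurable_sum => s.
apply: measurable_prod => i _.
rewrite (_ : (fun w => _) = X (i, s i)); last by apply/funext => w; rewrite mxE.
exact: measurable_funP.
Qed.

Lemma measurable_window (lo hi : R) :
  measurable [set w | lo <= `|permanent (random_matrix X w)| <= hi].
Proof.
have mf : measurable_fun [set: T] (fun w => `|permanent (random_matrix X w)|).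
  by apply: measurableT_comp => //; exact: measurable_permanent.
rewrite (_ : [set w | _] = [set: T] `&` (fun w => `|permanent (random_matrix X w)|) @^-1` `[lo, hi]).
  by apply: mf => //; exact: measurable_itv.
by rewrite classical_sets.setTI; apply/seteqP; split => w /=; rewrite in_itv.
Qed.

(** The window contains the disjoint union of the cells of good patterns, each of probability
    2^(-n^2). An inequality is claimed because entries may differ from 1 and -1 on a null set. *)
Lemma probability_window (lo hi : R) :
  mutually_independent X -> (forall ij, rademacher (X ij)) ->
  ((1 - mean n (fun f => (`|f finset.set0| < lo)%R%:R) (@start R n)
      - mean n (fun f => (hi < `|f finset.set0|)%R%:R) (@start R n))%:E
   <= P [set w | (lo <= `|permanent (random_matrix X w)| <= hi)%R])%E.
Proof.
move=> hI hR.
pose good (t : n.-tuple {set 'I_n}) := lo <= `|run (@start R n) t finset.set0| <= hi.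
have mE := measurable_window lo hi.
pose r := [seq t <- enum {: n.-tuple {set 'I_n}} | good t].
apply: (@le_trans _ _ (P (\bigcup_(t in [set` r]) cell t))); last first.
  apply: le_measure; [apply/mem_set|exact/mem_set|].
    apply: fin_bigcup_measurable => [|t _]; [exact: finite_seq|exact: measurable_cell].
  by move=> w [t /=]; rewrite mem_filter => /andP[gt _] ct; rewrite (cell_matrix ct).
rewrite measure_fin_bigcup; [|exact: finite_seq|exact: cell_trivI|by move=> t _; exact: measurable_cell].
rewrite -fsbig_seq; last by rewrite filter_uniq // enum_uniq.
rewrite /r big_filter big_enum_cond /=.
rewrite (eq_bigr (fun=> (((2 ^+ n) ^+ n)^-1)%:E)) => [|t _]; last exact: cell_prob.
rewrite sumEFin lee_fin !mean_tuples.
have p0 : 0 < (2 ^+ n) ^+ n :> R by rewrite !exprn_gt0.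
have one : 1 = (\sum_(t : n.-tuple {set 'I_n}) 1) / (2 ^+ n) ^+ n :> R.
  by have := @mean_tuples R n n (fun=> 1) (@start R n); rewrite mean_cst.
have -> : \sum_(t | good t) ((2 ^+ n) ^+ n)^-1 = (\sum_(t | good t) 1) / (2 ^+ n) ^+ n :> R.
  by rewrite mulr_suml; apply: eq_bigr => t _; rewrite mul1r.
rewrite {1}one -!mulrBl -!sumrB ler_pM2r ?invr_gt0 //.
rewrite [leRHS]big_mkcond; apply: ler_sum => t _; rewrite /good.
by case: ltP => h1; case: ltP => h2 /=; rewrite ?subr0 ?subrr ?sub0r.
Qed.

End Transfer.
(** The bound n! <= n^n cancels the main factor of the squared threshold and leaves n^(-2 eps n). *)
Lemma fact_powR_small (R : realType) (eps e : R) : 0 < eps -> 0 < e ->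
  exists M : nat, forall n, (M <= n)%N ->
    n`!%:R / (n%:R `^ ((2^-1 + eps) * n%:R)) ^+ 2 <= e.
Proof.
move=> eps0 e0; exists (Num.bound (expR 1 : R) + Num.bound (2 * eps * e)^-1)%N => n hn.
have n1 : expR 1 <= n%:R :> R.
  apply: le_trans (ltW (archi_boundP (expR_ge0 1))) _; rewrite ler_nat.
  by apply: leq_trans hn; rewrite leq_addr.
have ee0 : 0 < 2 * eps * e by rewrite !mulr_gt0.
have n2 : (2 * eps * e)^-1 <= n%:R.
  apply: le_trans (ltW (archi_boundP _)) _; first by rewrite invr_ge0 ltW.
  by rewrite ler_nat; apply: leq_trans hn; rewrite leq_addl.
have n0R : 0 < n%:R :> R by apply: lt_le_trans n1; exact: expR_gt0.
have l1 : 1 <= ln n%:R :> R by rewrite -[leLHS]expRK ler_ln ?posrE ?expR_gt0.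
have hf : n`!%:R <= n%:R ^+ n :> R.
  by rewrite -natrX ler_nat -[n`!]ffactnn leq_ffact_exp.
have hp : n%:R `^ ((2^-1 + eps) * n%:R) ^+ 2 = n%:R ^+ n * expR (2 * eps * n%:R * ln n%:R) :> R.
  rewrite /powR gt_eqF // -expRM_natl -[n%:R ^+ n in RHS](_ : expR (n%:R * ln n%:R) = _).
    by rewrite -expRD; congr expR; field.
  by rewrite expRM_natl lnK ?posrE.
rewrite hp ler_pdivrMr ?mulr_gt0 ?exprn_gt0 ?expR_gt0 //.
apply: le_trans hf _; rewrite mulrCA ler_peMr ?exprn_ge0 ?(ltW n0R) //.
rewrite -ler_pdivrMl // mulr1.
apply: (@le_trans _ _ (2 * eps * n%:R)).
  move: n2; rewrite -[leLHS]div1r ler_pdivrMr // => n2.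
  by rewrite -[leLHS]div1r ler_pdivrMr //; lra.
apply: (@le_trans _ _ (2 * eps * n%:R * ln n%:R)); first by rewrite ler_peMr // !mulr_ge0 // ltW.
by apply: le_trans (expR_ge1Dx _); rewrite lerDr.
Qed.

(** * Convergence of the window probability *)

Import numFieldNormedType.Exports.

Local Open Scope classical_set_scope.
Local Open Scope ring_scope.

Theorem theorem1p1 (R : realType) (d : nat -> measure_display)
    (T : forall n : nat, measurableType (d n))
    (P : forall n : nat, probability (T n) R)
    (X : forall n : nat, 'I_n * 'I_n -> {RV (P n) >-> R})
    (X_indep : forall n : nat, (1 <= n)%N -> mutually_independent (X n))
    (X_sign : forall n : nat, (1 <= n)%N ->
       forall ij : 'I_n * 'I_n, rademacher (X n ij)) :
  forall eps : R, 0 < eps ->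
    P n [set w | n%:R `^ ((2^-1 - eps) * n%:R)
                   <= `|permanent (random_matrix (X n) w)|
                   <= n%:R `^ ((2^-1 + eps) * n%:R)] @[n --> \oo] --> 1%E.
Proof.
move=> eps eps0.
have mA n := measurable_window (X n) (n%:R `^ ((2^-1 - eps) * n%:R)) (n%:R `^ ((2^-1 + eps) * n%:R)).
apply/fine_cvgP; split.
  by near=> n; apply: fin_num_measure.
apply/cvgrPdist_le => e e0.
(* [pfail_start_small] asks for eps <= 1; a larger eps only lowers the threshold, which [pfail_mono]
   allows. *)
have eps'0 : 0 < Num.min eps 1 by rewrite lt_min eps0 ltr01.
have eps'1 : Num.min eps 1 <= 1 by rewrite ge_min lexx orbT.
have e20 : 0 < e / 2 by rewrite divr_gt0.
have [M1 hM1] := pfail_start_small eps'0 eps'1 e20.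
have [M2 hM2] := fact_powR_small eps0 e20.
(* The summand 1 ensures n >= 1, as [X_indep] and [X_sign] require. *)
exists (M1 + M2 + 1)%N => // n /= hn.
have n1 : (1 <= n)%N by apply: leq_trans hn; rewrite leq_addl.
have n0R : 0 < n%:R :> R by rewrite ltr0n.
have := probability_window (n%:R `^ ((2^-1 - eps) * n%:R)) (n%:R `^ ((2^-1 + eps) * n%:R))
  (X_indep n n1) (X_sign n n1).
set A := [set w | _]; have fA : P n A \is a fin_num by exact: fin_num_measure.
have PA1 : (P n A <= 1)%E by exact: probability_le1.
rewrite -(fineK fA) !lee_fin in PA1 * => hP.
have hlo : mean n (fun f => (`|f finset.set0| < n%:R `^ ((2^-1 - eps) * n%:R))%R%:R) (@start R n) <= e / 2.
  rewrite -pfail_mean; apply: le_trans (hM1 n _); last first.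
    by apply: leq_trans hn; rewrite -addnA leq_addr.
  apply: pfail_mono; rewrite ler_powR ?ler1n // ler_pM2r // lerD2l lerN2.
  by rewrite ge_min lexx.
have hhi : mean n (fun f => (n%:R `^ ((2^-1 + eps) * n%:R) < `|f finset.set0|)%R%:R) (@start R n) <= e / 2.
  apply: le_trans (mean_large_values _ (powR_gt0 _ n0R)) _; apply: hM2.
  by apply: leq_trans hn; rewrite -addnA addnCA leq_addr.
by rewrite ger0_norm; lra.
Unshelve. all: by end_near.
Qed.
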